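(* Let $g\in H^\infty(\mathbb{D})$ be such that $g(\mathbb{D})\cap\mathbb{D}=\varnothing$, $|g|>1$ almost everywhere on $\mathbb{T}$, and $\log(|g|-1)\in L^1(\mathbb{T})$. Then for every $k>0$ and every non-zero $f\in H^2(\mathbb{D})$, $\lim_{n\to\infty}n^{-k}\|(T_g^* )^nf\|=+\infty$.
   Context: $\mathbb{D}$ is the open unit disk, $\mathbb{T}$ the unit circle with normalized Lebesgue measure; $H^\infty$ functions are identified with their boundary values on $\mathbb{T}$. $H^2(\mathbb{D})\subseteq L^2(\mathbb{T})$; for $g\in L^\infty(\mathbb{T})$, $T_g=PM_g$ with $M_g$ multiplication by $g$ and $P$ the orthogonal projection of $L^2(\mathbb{T})$ onto $H^2(\mathbb{D})$; $T_g^*$ is the Hilbert space adjoint. *)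

(* Defs.v *)
From HB Require Import structures.
From mathcomp Require Import all_boot all_order all_algebra.
From mathcomp Require Import complex.
From mathcomp Require Import all_classical all_reals all_analysis.
Set Implicit Arguments. Unset Strict Implicit. Unset Printing Implicit Defensive.
Import Order.TTheory GRing.Theory Num.Theory.
Import numFieldNormedType.Exports.
Local Open Scope classical_set_scope.
Local Open Scope ring_scope.

Section Hardy.
Context {R : realType}.

Definition cRe (z : R[i]) : R := @complex.Re R z.
Definition cIm (z : R[i]) : R := @complex.Im R z.

Definition cabs (z : R[i]) : R := ComplexField.Normc.normc z.

Definition expi (t : R) : R[i] := Complex (cos t) (sin t).

(** the circle T is parametrized by t in [0, 2 pi] (endpoints are null);
    mu is Lebesgue measure *)
Definition Tdom : set R := `[0, 2 * pi]%classic.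
Local Notation mu := (@lebesgue_measure R).

Definition cint (u : R -> R[i]) : R[i] :=
  Complex ((2 * pi)^-1 * Rintegral mu Tdom (fun t => cRe (u t)))
          ((2 * pi)^-1 * Rintegral mu Tdom (fun t => cIm (u t))).

Definition L2 (u : R -> R[i]) : Prop :=
  measurable_fun Tdom (fun t => cRe (u t)) /\
  measurable_fun Tdom (fun t => cIm (u t)) /\
  mu.-integrable Tdom (fun t => ((cabs (u t)) ^+ 2)%:E).

Definition ip (u v : R -> R[i]) : R[i] := cint (fun t => u t * conjc (v t)).

Definition l2norm (u : R -> R[i]) : R :=
  Num.sqrt ((2 * pi)^-1 * Rintegral mu Tdom (fun t => (cabs (u t)) ^+ 2)).

(** H^2(D) as a subspace of L^2(T): the Fourier coefficients of negative
    index vanish: for n >= 1,  int u(t) e^{i n t} dm(t) = 0 *)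
Definition H2 (u : R -> R[i]) : Prop :=
  L2 u /\ forall n : nat, (0 < n)%N -> cint (fun t => u t * expi (n%:R * t)) = 0.

Definition ccvg_seq (s : nat -> R[i]) (l : R[i]) : Prop :=
  (fun n => cRe (s n)) @ \oo --> cRe l /\ (fun n => cIm (s n)) @ \oo --> cIm l.

Definition holo_disc (G : R[i] -> R[i]) : Prop :=
  exists a : nat -> R[i], forall z : R[i], cabs z < 1 ->
    ccvg_seq (fun N => \sum_(0 <= k < N) a k * z ^+ k) (G z).

Definition Hinf (G : R[i] -> R[i]) : Prop :=
  holo_disc G /\ exists M : R, forall z, cabs z < 1 -> cabs (G z) <= M.

Definition boundary_values (G : R[i] -> R[i]) (gb : R -> R[i]) : Prop :=
  {ae mu, forall t, Tdom t ->
    (fun r : R => cRe (G (Complex r 0 * expi t))) @ at_left 1 --> cRe (gb t) /\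
    (fun r : R => cIm (G (Complex r 0 * expi t))) @ at_left 1 --> cIm (gb t)}.

(** A is (a representative of) the Hilbert adjoint T_g^* of the Toeplitz
    operator T_g = P M_g on H^2, where g = gb: A maps H^2 into H^2 and,
    for all u, h in H^2 and w = P(g u) (the element of H^2 with
    g u - w orthogonal to H^2),  <T_g u, h> = <w, h> = <u, A h>. *)
Definition is_Toeplitz_adjoint (gb : R -> R[i]) (A : (R -> R[i]) -> (R -> R[i]))
  : Prop :=
  (forall h, H2 h -> H2 (A h)) /\
  forall u h w, H2 u -> H2 h -> H2 w ->
    (forall v, H2 v -> ip (fun t => gb t * u t - w t) v = 0) ->
    ip w h = ip u (A h).

End Hardy.

(* Main.v *)
(** For [u] in [H^2] the adjoint relation gives [<u, A^n f> = <g^n u, f>].  Take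
    [u = g^-n z^j p], where [z^j] is a Fourier mode of [f] and [p] is a polynomial
    depending on [n]: then [<g^n u, f> = <z^j p, f>] stays away from [0] as soon
    as [p] is close to [1] in [H^2], and it remains to make [u] small.

    Let [l = 2K log(1 - 1/|g|)], integrable by hypothesis, and
    [xi = min(l + m, 0)], whose [L^1] norm tends to [0] as [m] grows.  Fejér means
    produce polynomials [S] with [Re S <= 0] on the circle and [Re S] close to
    [xi] in [L^1]; then [p = (1 + S/2N)^N], with [N] large, satisfies
    [|p|^2 <= exp(Re S) + eps], a substitute for the outer function of modulus
    [exp(xi/2)].  On the one hand [|p - 1|^2 = |p|^2 + 1 - 2 Re p(0)] in mean,
    which is small because [p(0) >= 1 + (mean of Re S)/2]; on the other hand
    [|u|^2 <= e^m (mean of |g|^-2n (1 - 1/|g|)^2K) + O(eps) = O(n^-2K)] for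
    [eps = n^-2K].  Hence [|A^n f| >= c n^K] for every [K].

    That [1/g] is again the boundary function of a bounded analytic function is
    seen on polynomial approximants of [z |-> G(r z)]: they do not vanish on the
    closed disc, so their reciprocals are uniform limits of polynomials on the
    circle. *)
Require Import Defs.
From HB Require Import structures.
From mathcomp Require Import all_boot all_order all_algebra.
From mathcomp Require Import complex.
From mathcomp Require Import all_classical all_reals all_analysis.
From mathcomp Require Import measurable_realfun.
From mathcomp Require Import ring lra.
Set Implicit Arguments.
Unset Strict Implicit.
Import Order.TTheory GRing.Theory Num.Theory.
Import numFieldNormedType.Exports.
Local Open Scope classical_set_scope.
Local Open Scope ring_scope.

(** * Complex numbers *)

Section ComplexModulus.
Context {R : realType}.
Implicit Types (x y z : R[i]) (t : R).

Lemma cReD x y : cRe (x + y) = cRe x + cRe y. Proof. by case: x y => [a b] [c d]. Qed.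
Lemma cImD x y : cIm (x + y) = cIm x + cIm y. Proof. by case: x y => [a b] [c d]. Qed.
Lemma cReN x : cRe (- x) = - cRe x. Proof. by case: x. Qed.
Lemma cImN x : cIm (- x) = - cIm x. Proof. by case: x. Qed.
Lemma cReM x y : cRe (x * y) = cRe x * cRe y - cIm x * cIm y.
Proof. by case: x y => [a b] [c d]. Qed.
Lemma cImM x y : cIm (x * y) = cRe x * cIm y + cIm x * cRe y.
Proof. by case: x y => [a b] [c d]. Qed.
Lemma cReJ x : cRe (conjc x) = cRe x. Proof. by case: x. Qed.
Lemma cImJ x : cIm (conjc x) = - cIm x. Proof. by case: x. Qed.
Lemma cRe_eq x y : cRe x = cRe y -> cIm x = cIm y -> x = y.
Proof. by case: x y => [a b] [c d] /= -> ->. Qed.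

Lemma cabs_ge0 z : 0 <= cabs z.
Proof. by case: z => a b; rewrite /cabs /= sqrtr_ge0. Qed.
Lemma cabs_sqr z : cabs z ^+ 2 = cRe z ^+ 2 + cIm z ^+ 2.
Proof. by case: z => a b; rewrite /cabs /= sqr_sqrtr// addr_ge0// sqr_ge0. Qed.
Lemma cabsM x y : cabs (x * y) = cabs x * cabs y.
Proof. exact: ComplexField.Normc.normcM. Qed.
Lemma cabsD x y : cabs (x + y) <= cabs x + cabs y.
Proof. exact: le_normcD. Qed.
Lemma cabsN x : cabs (- x) = cabs x.
Proof. exact: normcN. Qed.
Lemma cabsB x y : cabs (x - y) <= cabs x + cabs y.
Proof. by rewrite (le_trans (cabsD _ _))// cabsN. Qed.
Lemma cabs_dist x y : cabs (x - y) = cabs (y - x).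
Proof. by rewrite -cabsN opprB. Qed.
Lemma cabs0 : cabs (0 : R[i]) = 0.
Proof. exact: ComplexField.Normc.normc0. Qed.
Lemma cabs1 : cabs (1 : R[i]) = 1.
Proof. exact: ComplexField.Normc.normc1. Qed.
Lemma cabsV x : cabs x^-1 = (cabs x)^-1.
Proof. exact: ComplexField.Normc.normcV. Qed.
Lemma cabsX x n : cabs (x ^+ n) = cabs x ^+ n.
Proof. by elim: n => [|n IH]; rewrite ?expr0 ?cabs1// !exprS cabsM IH. Qed.
Lemma cabs_eq0 x : cabs x = 0 -> x = 0.
Proof. exact: ComplexField.Normc.eq0_normc. Qed.
Lemma cabs_real (a : R) : cabs (Complex a 0) = `|a|.
Proof. by rewrite /cabs /= expr0n/= addr0 sqrtr_sqr. Qed.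
Lemma cabsJ x : cabs (conjc x) = cabs x.
Proof. by case: x => a b; rewrite /cabs /= sqrrN. Qed.

Lemma ler_cRe z : `|cRe z| <= cabs z.
Proof.
by rewrite -(ler_pXn2r (n := 2))// ?nnegrE ?cabs_ge0// cabs_sqr real_normK ?num_real// lerDl sqr_ge0.
Qed.
Lemma ler_cIm z : `|cIm z| <= cabs z.
Proof.
by rewrite -(ler_pXn2r (n := 2))// ?nnegrE ?cabs_ge0// cabs_sqr real_normK ?num_real// lerDr sqr_ge0.
Qed.
Lemma cabs_le z : cabs z <= `|cRe z| + `|cIm z|.
Proof.
rewrite -(ler_pXn2r (n := 2))// ?nnegrE ?cabs_ge0 ?addr_ge0// cabs_sqr.
have := normr_ge0 (cRe z); have := normr_ge0 (cIm z).
rewrite -(real_normK (num_real (cRe z))) -(real_normK (num_real (cIm z))); nra.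
Qed.

Lemma cabs_sum (I : Type) (s : seq I) (F : I -> R[i]) :
  cabs (\sum_(i <- s) F i) <= \sum_(i <- s) cabs (F i).
Proof.
elim/big_ind2 : _ => //; first by rewrite cabs0.
by move=> x1 x2 y1 y2 h1 h2; rewrite (le_trans (cabsD _ _))// lerD.
Qed.

Lemma expi0 : expi 0 = 1 :> R[i]. Proof. by rewrite /expi cos0 sin0. Qed.
Lemma expiD s t : expi (s + t) = expi s * expi t.
Proof. by rewrite /expi cosD sinD; apply: cRe_eq => /=; ring. Qed.
Lemma expiX n t : expi (n%:R * t) = expi t ^+ n.
Proof.
elim: n => [|n IH]; first by rewrite mul0r expi0 expr0.
by rewrite -natr1 mulrDl mul1r expiD IH exprSr.
Qed.
Lemma cabs_expi t : cabs (expi t) = 1.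
Proof. by rewrite /cabs /= cos2Dsin2 sqrtr1. Qed.
Lemma Re_Im_continuous_poly (p : {poly R[i]}) :
  continuous (fun t => cRe p.[expi t]) /\ continuous (fun t => cIm p.[expi t]).
Proof.
elim/poly_ind: p => [|p c [cr ci]].
  by split => t; under eq_fun do rewrite horner0; exact: cvg_cst.
split.
  rewrite (_ : (fun _ => _) = fun t => cRe p.[expi t] * cos t - cIm p.[expi t] * sin t + cRe c); last first.
    by apply/funext => t; rewrite hornerMXaddC cReD cReM.
  move=> x; apply: cvgD; last exact: cvg_cst.
  apply: cvgB; apply: cvgM; [exact: cr|exact: continuous_cos|exact: ci|exact: continuous_sin].
rewrite (_ : (fun _ => _) = fun t => cRe p.[expi t] * sin t + cIm p.[expi t] * cos t + cIm c); last first.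
  by apply/funext => t; rewrite hornerMXaddC cImD cImM.
move=> x; apply: cvgD; last exact: cvg_cst.
apply: cvgD; apply: cvgM; [exact: cr|exact: continuous_sin|exact: ci|exact: continuous_cos].
Qed.

Lemma cabs_poly_bounded (p : {poly R[i]}) :
  exists2 B : R, 0 <= B & forall z, cabs z <= 1 -> cabs p.[z] <= B.
Proof.
elim/poly_ind: p => [|p c [B B0 hB]].
  by exists 0 => // z _; rewrite horner0 cabs0.
exists (B + cabs c); first by rewrite addr_ge0 ?cabs_ge0.
move=> z z1; rewrite hornerMXaddC (le_trans (cabsD _ _))// lerD2r cabsM.
by rewrite -[leRHS]mulr1 ler_pM ?cabs_ge0 ?hB.
Qed.

End ComplexModulus.

(** * Means over the circle *)

Section CircleMean.
Context {R : realType}.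
Local Notation mu := (@lebesgue_measure R).
Implicit Types (f g : R -> R) (u v : R -> R[i]).

(** The real and imaginary parts of [cint] are [avg] by conversion, so the real lemmas below act on
    them directly. *)
Definition avg f : R := (2 * pi)^-1 * Rintegral mu Tdom f.
Definition intg f : Prop := mu.-integrable Tdom (EFin \o f).

Lemma twopi_gt0 : 0 < 2 * pi :> R. Proof. by rewrite mulr_gt0// pi_gt0. Qed.

Lemma measurable_Tdom : measurable (Tdom : set (measurableTypeR R)).
Proof. exact: measurable_itv. Qed.
#[local] Hint Resolve measurable_Tdom : core.

Lemma mu_Tdom : mu Tdom = (2 * pi)%:E.
Proof. by rewrite /Tdom lebesgue_measure_itv /= lte_fin twopi_gt0 oppr0 adde0. Qed.

Lemma mu_Tdom_lty : (mu Tdom < +oo)%E. Proof. by rewrite mu_Tdom ltry. Qed.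
#[local] Hint Resolve mu_Tdom_lty : core.

Lemma intg_measurable f : intg f -> measurable_fun Tdom f.
Proof. by case/integrableP => /measurable_EFinP. Qed.

Lemma intg_le f g : measurable_fun Tdom f -> intg g ->
  (forall t, Tdom t -> `|f t| <= g t) -> intg f.
Proof.
move=> mf ig fg; apply: le_integrable ig => //; first exact/measurable_EFinP.
by move=> t Dt /=; rewrite lee_fin (le_trans (fg t Dt))// ler_norm.
Qed.

Lemma intg_continuous f : continuous f -> intg f.
Proof.
move=> cf; apply: continuous_compact_integrable; first exact: segment_compact.
exact: continuous_subspaceT.
Qed.

Lemma intg_cst (c : R) : intg (fun=> c).
Proof. by apply: intg_continuous => t; exact: cvg_cst. Qed.

Lemma intg_bounded f (c : R) : measurable_fun Tdom f ->
  (forall t, Tdom t -> `|f t| <= c) -> intg f.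
Proof. by move=> mf fc; apply: (intg_le mf (intg_cst c)). Qed.

Lemma intgD f g : intg f -> intg g -> intg (fun t => f t + g t).
Proof. by move=> hf hg; have := integrableD measurable_Tdom hf hg. Qed.

Lemma intgZ (c : R) f : intg f -> intg (fun t => c * f t).
Proof. by move=> hf; have := integrableZl measurable_Tdom c hf. Qed.

Lemma intgN f : intg f -> intg (fun t => - f t).
Proof. by move=> hf; have := integrableN hf. Qed.

Lemma intgB f g : intg f -> intg g -> intg (fun t => f t - g t).
Proof. by move=> hf hg; apply: intgD => //; exact: intgN. Qed.

Lemma intg_norm f : intg f -> intg (fun t => `|f t|).
Proof. by move/integrable_norm. Qed.

Lemma continuous_measurable_Tdom f : continuous f -> measurable_fun Tdom f.
Proof. by move/intg_continuous/intg_measurable. Qed.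

Lemma avgD f g : intg f -> intg g -> avg (fun t => f t + g t) = avg f + avg g.
Proof. by move=> hf hg; rewrite /avg RintegralD// mulrDr. Qed.

Lemma avgB f g : intg f -> intg g -> avg (fun t => f t - g t) = avg f - avg g.
Proof. by move=> hf hg; rewrite /avg RintegralB// mulrBr. Qed.

Lemma avgZ (c : R) f : intg f -> avg (fun t => c * f t) = c * avg f.
Proof. by move=> hf; rewrite /avg RintegralZl// mulrCA. Qed.

Lemma avg_cst (c : R) : avg (fun=> c) = c.
Proof.
rewrite /avg Rintegral_cst// [X in _ * (_ * X)](_ : _ = 2 * pi).
  by rewrite mulrCA mulVf ?mulr1// gt_eqF// twopi_gt0.
exact: (congr1 fine mu_Tdom).
Qed.

Lemma eq_avg f g : (forall t, Tdom t -> f t = g t) -> avg f = avg g.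
Proof. by move=> fg; congr (_ * _); apply: eq_Rintegral => t /set_mem /fg. Qed.

Lemma avg_le f g : intg f -> intg g -> (forall t, Tdom t -> f t <= g t) ->
  avg f <= avg g.
Proof.
by move=> hf hg fg; rewrite ler_pM2l ?invr_gt0 ?twopi_gt0//; exact: le_Rintegral.
Qed.

Lemma avg_ge0 f : (forall t, Tdom t -> 0 <= f t) -> 0 <= avg f.
Proof.
move=> f0; apply: mulr_ge0; last exact: Rintegral_ge0.
by rewrite invr_ge0 ltW// twopi_gt0.
Qed.

Lemma ler_norm_avg f : intg f -> `|avg f| <= avg (fun t => `|f t|).
Proof.
move=> hf; rewrite normrM gtr0_norm ?invr_gt0 ?twopi_gt0//.
by rewrite ler_pM2l ?invr_gt0 ?twopi_gt0//; exact: le_normr_Rintegral.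
Qed.

Lemma ae_sub (P Q : R -> Prop) : {ae mu, forall t, P t} ->
  (forall t, P t -> Q t) -> {ae mu, forall t, Q t}.
Proof.
move=> [N [mN N0 PN]] PQ; exists N; split=> // t nQ; apply: PN.
by apply: contra_not nQ => /PQ.
Qed.

Lemma ae_and (P Q : R -> Prop) : {ae mu, forall t, P t} ->
  {ae mu, forall t, Q t} -> {ae mu, forall t, P t /\ Q t}.
Proof.
move=> [N [mN N0 PN]] [M [mM M0 QM]]; exists (N `|` M); split.
- exact: measurableU.
- exact: null_set_setU.
- move=> t nPQ; have [Pt|nP] := pselect (P t); last by left; exact: PN.
  by right; apply: QM => Qt; exact: nPQ.
Qed.

Lemma ae_all (P : R -> Prop) : (forall t, P t) -> {ae mu, forall t, P t}.
Proof. by move=> h; exists set0; split=> // t nP; exact: nP. Qed.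

Lemma avg_dominated (F : nat -> R -> R) f g :
  (forall n, measurable_fun Tdom (F n)) -> measurable_fun Tdom f ->
  {ae mu, forall t, Tdom t -> F ^~ t @ \oo --> f t} ->
  intg g -> (forall n t, Tdom t -> `|F n t| <= g t) ->
  intg f /\ avg (F n) @[n --> \oo] --> avg f.
Proof.
move=> mF mf Ff ig Fg.
have [|||||h1 _ h3] := @dominated_convergence _ _ _ mu Tdom measurable_Tdom
  (fun n t => (F n t)%:E) (EFin \o f) (EFin \o g).
- by move=> n; apply/measurable_EFinP; exact: mF.
- exact/measurable_EFinP.
- apply: (ae_sub Ff) => t h Dt; apply: cvg_EFin; first by exact: nearW.
  exact: h.
- exact: ig.
- by apply: ae_all => t n Dt /=; rewrite lee_fin Fg.
split=> //; apply: cvgM; first exact: cvg_cst.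
have ff : (\int[mu]_(x in Tdom) (EFin \o f) x)%E \is a fin_num.
  exact: integrable_fin_num.
rewrite /Rintegral; apply: fine_cvg; rewrite fineK//.
Qed.

Lemma avg_abs_eq0 f : intg f -> avg (fun t => `|f t|) = 0 ->
  {ae mu, forall t, Tdom t -> f t = 0}.
Proof.
move=> hf /eqP; rewrite mulf_eq0 invr_eq0 gt_eqF ?twopi_gt0//= => /eqP h.
have : (\int[mu]_(x in Tdom) `|(EFin \o f) x| = 0)%E.
  rewrite -[LHS]fineK//; first by rewrite [X in X%:E](_ : _ = 0).
  by apply: integrable_fin_num => //; exact: integrable_abse.
have mf : measurable_fun Tdom (EFin \o f) by case/integrableP : hf.
move/(ae_eq_integral_abs mu measurable_Tdom mf).
by move/ae_sub; apply => t /= h' Dt; have [] := h' Dt.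
Qed.

Import HBNNSimple.

(** The integral of a nonnegative function is a supremum over the simple functions below it. Each of
    these is measurable and vanishes off [N], which settles the case of an arbitrary [f]. *)
Lemma ge0_integral_null (N : set R) (f : R -> \bar R) : measurable N -> mu N = 0 ->
  (forall t, 0 <= f t)%E -> (forall t, ~ N t -> f t = 0%E) ->
  (\int[mu]_t f t = 0)%E.
Proof.
move=> mN N0 f0 fN; apply/eqP; rewrite eq_le integral_ge0// andbT.
rewrite ge0_integralTE//; apply: ub_ereal_sup => _ [h /= hf <-].
rewrite -integralT_nnsfun.
rewrite (@ae_eq_integral _ _ _ mu setT (cst 0%E)) ?integral0//.
  by apply/measurable_EFinP.
exists N; split=> // t; apply: contra_notP => Nt _ /=; congr EFin.
by apply/eqP; rewrite eq_le fun_ge0 andbT -lee_fin (le_trans (hf t))// fN.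
Qed.

(* No measurability is assumed: the boundary function [g] of the theorem need
   only agree almost everywhere with a Borel function. *)
Lemma avg_null f (N : set R) : measurable N -> mu N = 0 ->
  (forall t, Tdom t -> ~ N t -> f t = 0) -> avg f = 0.
Proof.
move=> mN N0 fN; rewrite /avg /Rintegral integral_mkcond integralE.
rewrite !(@ge0_integral_null N)// ?subee//= ?mulr0// => t Nt;
  rewrite ?funeposE ?funenegE patchE; case: (boolP (t \in Tdom)) => [/set_mem Dt|_] /=;
  by rewrite ?fN// ?oppr0 ?oppe0 maxxx.
Qed.

End CircleMean.
#[local] Hint Resolve measurable_Tdom mu_Tdom_lty : core.

(** * Complex means and orthogonality of Fourier modes *)

Section ComplexMean.
Context {R : realType}.
Local Notation mu := (@lebesgue_measure R).
Implicit Types (u v : R -> R[i]) (p : {poly R[i]}).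

Definition cmeas u := measurable_fun Tdom (fun t => cRe (u t)) /\
  measurable_fun Tdom (fun t => cIm (u t)).
Definition cintg u := intg (fun t => cRe (u t)) /\ intg (fun t => cIm (u t)).

Lemma eq_cint u v : (forall t, Tdom t -> u t = v t) -> cint u = cint v.
Proof.
by move=> uv; congr Complex; congr (_ * _); apply: eq_Rintegral => t /set_mem /uv ->.
Qed.

Lemma cintgZ (c : R[i]) u : cintg u -> cintg (fun t => c * u t).
Proof.
move=> [u1 u2]; split.
  by under eq_fun do rewrite cReM; apply: intgB; exact: intgZ.
by under eq_fun do rewrite cImM; apply: intgD; exact: intgZ.
Qed.

Lemma cintD u v : cintg u -> cintg v ->
  cint (fun t => u t + v t) = cint u + cint v.
Proof.
move=> [u1 u2] [v1 v2]; apply: cRe_eq; rewrite ?cReD ?cImD /=.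
  by rewrite -(avgD u1 v1); apply: eq_avg => t _; rewrite cReD.
by rewrite -(avgD u2 v2); apply: eq_avg => t _; rewrite cImD.
Qed.

Lemma cintZ (c : R[i]) u : cintg u -> cint (fun t => c * u t) = c * cint u.
Proof.
move=> [u1 u2]; apply: cRe_eq; rewrite ?cReM ?cImM /=.
  rewrite -(avgZ _ u1) -(avgZ _ u2) -avgB; do ?exact: intgZ.
  by apply: eq_avg => t _; rewrite cReM.
rewrite -(avgZ _ u1) -(avgZ _ u2) -avgD; do ?exact: intgZ.
by apply: eq_avg => t _; rewrite cImM.
Qed.

Lemma cint_cst (c : R[i]) : cint (fun=> c) = c.
Proof. by apply: cRe_eq; rewrite /= -[LHS]/(avg _) avg_cst. Qed.

(** Fundamental theorem of calculus over one period; applied to sines and cosines it kills every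
    nonconstant Fourier mode. *)
Lemma avg_derive (F f : R -> R) : (forall x : R, is_derive x (1 : R) F (f x)) ->
  continuous f -> F (2 * pi) = F 0 -> avg f = 0.
Proof.
move=> dF cf F0; have cF : continuous F.
  by move=> x; apply: differentiable_continuous; apply/derivable1_diffP; exact: ex_derive.
rewrite /avg /Rintegral (@continuous_FTC2 _ _ F).
- by rewrite F0 /= subrr mulr0.
- exact: twopi_gt0.
- exact: continuous_subspaceT.
- split; [by move=> x _; exact: ex_derive|by apply: cvg_at_right_filter; exact: cF|].
  by apply: cvg_at_left_filter; exact: cF.
- by move=> x _; rewrite derive1E derive_val.
Qed.

Lemma expi_2npi n : expi (n%:R * (2 * pi)) = 1 :> R[i].
Proof. by rewrite expiX /expi mulr_natl cos2pi sin2pi expr1n. Qed.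

Lemma avg_cos n : avg (fun t => cos (n.+1%:R * t)) = 0 :> R.
Proof.
apply: (@avg_derive (fun t => n.+1%:R^-1 * sin (n.+1%:R * t))).
- by move=> x; apply: is_derive_eq; rewrite /GRing.scale /=; field.
- move=> x; apply: continuous_comp; last exact: continuous_cos.
  by apply: cvgM; [exact: cvg_cst|exact: cvg_id].
- by have [_ ->] := expi_2npi n.+1; rewrite !mulr0 sin0 mulr0.
Qed.

Lemma avg_sin n : avg (fun t => sin (n.+1%:R * t)) = 0 :> R.
Proof.
apply: (@avg_derive (fun t => - n.+1%:R^-1 * cos (n.+1%:R * t))).
- by move=> x; apply: is_derive_eq; rewrite /GRing.scale /=; field.
- move=> x; apply: continuous_comp; last exact: continuous_sin.
  by apply: cvgM; [exact: cvg_cst|exact: cvg_id].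
- by have [-> _] := expi_2npi n.+1; rewrite mulr0 cos0.
Qed.

Lemma cint_expiX n : cint (fun t => expi t ^+ n.+1) = 0 :> R[i].
Proof.
apply: cRe_eq; rewrite /= -[LHS]/(avg _); [rewrite -(avg_cos n)|rewrite -(avg_sin n)];
  by apply: eq_avg => t _; rewrite -expiX.
Qed.

Lemma cintg_poly p : cintg (fun t => p.[expi t]).
Proof. by have [? ?] := Re_Im_continuous_poly p; split; exact: intg_continuous. Qed.

Lemma cmeas_poly p : cmeas (fun t => p.[expi t]).
Proof. by have [? ?] := @cintg_poly p; split; exact: intg_measurable. Qed.

(** Keeping [n] general absorbs the extra factor [X] produced by the Horner step. *)
Lemma cint_polyX n p : cint (fun t => p.[expi t] * expi t ^+ n.+1) = 0.
Proof.
elim/poly_ind: p n => [|p c IH] n.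
  by rewrite -(cint_cst 0); apply: eq_cint => t _; rewrite horner0 mul0r.
have cX : cintg (fun t => expi t ^+ n.+1).
  rewrite (_ : (fun t => _) = fun t => ('X^(n.+1)).[expi t]); first exact: cintg_poly.
  by apply/funext => t; rewrite hornerXn.
rewrite (@eq_cint _ (fun t => p.[expi t] * expi t ^+ n.+2 + c * expi t ^+ n.+1)).
  rewrite cintD ?cintZ ?IH ?cint_expiX ?mulr0 ?addr0//; last exact: cintgZ.
  rewrite (_ : (fun t => _) = fun t => (p * 'X^(n.+2)).[expi t]); first exact: cintg_poly.
  by apply/funext => t; rewrite hornerM hornerXn.
by move=> t _; rewrite hornerMXaddC mulrDl -mulrA -exprS.
Qed.

(** Mean value property at the centre of the disc: multiples of [X] have mean zero, so only the
    constant term remains. *)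
Lemma cint_poly p : cint (fun t => p.[expi t]) = p.[0].
Proof.
elim/poly_ind: p => [|p c IH].
  by rewrite horner0 -(cint_cst 0); apply: eq_cint => t _; rewrite horner0.
have := @cintg_poly (p * 'X); have cc : cintg (fun=> c) by split; exact: intg_cst.
move=> cp; rewrite (@eq_cint _ (fun t => (p * 'X).[expi t] + c)); last first.
  by move=> t _; rewrite hornerMXaddC hornerMX.
rewrite cintD// cint_cst hornerMXaddC mulr0; congr (_ + _).
by rewrite -(cint_polyX 0 p); apply: eq_cint => t _; rewrite hornerMX.
Qed.

End ComplexMean.

(** * Square integrable functions and bounded analytic boundary functions *)

Section SquareIntegrable.
Context {R : realType}.
Local Notation mu := (@lebesgue_measure R).
Implicit Types (u v b : R -> R[i]) (p : {poly R[i]}).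

Definition sqn u : R := avg (fun t => cabs (u t) ^+ 2).

Lemma sqn_ge0 u : 0 <= sqn u.
Proof. by apply: avg_ge0 => t _; rewrite sqr_ge0. Qed.

Lemma l2norm_sqr u : l2norm u ^+ 2 = sqn u.
Proof. by rewrite sqr_sqrtr// sqn_ge0. Qed.

Lemma cmeasM u v : cmeas u -> cmeas v -> cmeas (fun t => u t * v t).
Proof.
move=> [u1 u2] [v1 v2]; split.
  under eq_fun do rewrite cReM.
  by apply: measurable_funB; exact: measurable_funM.
under eq_fun do rewrite cImM.
by apply: measurable_funD; exact: measurable_funM.
Qed.

Lemma cmeasJ u : cmeas u -> cmeas (fun t => conjc (u t)).
Proof.
move=> [u1 u2]; split; first by under eq_fun do rewrite cReJ.
by under eq_fun do rewrite cImJ; exact: measurableT_comp.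
Qed.

Lemma measurable_cabs u : cmeas u -> measurable_fun Tdom (fun t => cabs (u t)).
Proof.
move=> [u1 u2].
rewrite (_ : (fun t => _) = fun t => Num.sqrt (cRe (u t) ^+ 2 + cIm (u t) ^+ 2)).
  apply: measurableT_comp; first by apply: continuous_measurable_fun; exact: sqrt_continuous.
  by apply: measurable_funD; exact: measurable_funX.
by apply/funext => t; rewrite -cabs_sqr sqrtr_sqr ger0_norm// cabs_ge0.
Qed.

Lemma L2_cmeas u : L2 u -> cmeas u. Proof. by case=> ? []. Qed.

Lemma L2_bounded u (c : R) : cmeas u -> (forall t, Tdom t -> cabs (u t) <= c) -> L2 u.
Proof.
move=> mu' uc; split; [by case: mu'|split; first by case: mu'].
apply: (@intg_bounded R (fun t => cabs (u t) ^+ 2) (c ^+ 2)).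
  by apply: measurable_funX; exact: measurable_cabs.
by move=> t Dt; rewrite ger0_norm ?sqr_ge0// lerXn2r ?nnegrE ?cabs_ge0 ?uc//
  (le_trans _ (uc t Dt))// cabs_ge0.
Qed.

Lemma mul_le_amgm (x y s : R) : 0 < s -> 2 * (x * y) <= s * x ^+ 2 + s^-1 * y ^+ 2.
Proof.
move=> s0; have -> : s * x ^+ 2 + s^-1 * y ^+ 2 = 2 * (x * y) + s^-1 * (s * x - y) ^+ 2.
  by field; rewrite gt_eqF.
by rewrite lerDl mulr_ge0 ?invr_ge0 ?sqr_ge0// ltW.
Qed.

Lemma L2_intg_sqr u : L2 u -> intg (fun t => cabs (u t) ^+ 2).
Proof. by case=> _ []. Qed.

Lemma intg_amgm u v (s : R) : L2 u -> L2 v ->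
  intg (fun t => s * cabs (u t) ^+ 2 + s^-1 * cabs (v t) ^+ 2).
Proof. by move=> hu hv; apply: intgD; apply: intgZ; exact: L2_intg_sqr. Qed.

Lemma cintg_ip u v : L2 u -> L2 v -> cintg (fun t => u t * conjc (v t)).
Proof.
move=> hu hv; have [m1 m2] := cmeasM (L2_cmeas hu) (cmeasJ (L2_cmeas hv)).
have H t : cabs (u t * conjc (v t)) <= 1 * cabs (u t) ^+ 2 + 1^-1 * cabs (v t) ^+ 2.
  rewrite cabsM cabsJ; have := mul_le_amgm (cabs (u t)) (cabs (v t)) (@ltr01 R).
  have := mulr_ge0 (cabs_ge0 (u t)) (cabs_ge0 (v t)); lra.
split; apply: (intg_le _ (intg_amgm 1 hu hv)) => // t _; apply: le_trans (H t).
  exact: ler_cRe.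
exact: ler_cIm.
Qed.

(** A weighted AM-GM stand-in for Cauchy-Schwarz; the weight [s] is chosen at each use to make one
    of the two terms small. The modulus is bounded by the sum of the absolute real and imaginary
    parts, each at most half of the right-hand side. *)
Lemma ip_amgm u v (s : R) : L2 u -> L2 v -> 0 < s ->
  cabs (ip u v) <= s * sqn u + s^-1 * sqn v.
Proof.
move=> hu hv s0; have [i1 i2] := cintg_ip hu hv.
have i3 := intg_amgm s hu hv.
have H (w : R -> R) : intg w -> (forall t, `|w t| <= cabs (u t * conjc (v t))) ->
    2 * `|avg w| <= s * sqn u + s^-1 * sqn v.
  move=> iw hw; rewrite (le_trans (ler_wpM2l _ (ler_norm_avg iw)))//.
  rewrite -(avgZ _ (intg_norm iw)) /sqn -(avgZ _ (L2_intg_sqr hu)) -(avgZ _ (L2_intg_sqr hv)).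
  rewrite -avgD; do ?exact: intgZ (L2_intg_sqr _).
  apply: avg_le => //; first by apply: intgZ; exact: intg_norm.
  move=> t _; apply: le_trans (mul_le_amgm _ _ s0).
  by rewrite ler_pM2l// -(cabsJ (v t)) -cabsM hw.
have := H _ i1 (fun t => ler_cRe _); have := H _ i2 (fun t => ler_cIm _).
have := cabs_le (ip u v).
rewrite [cRe (ip u v)](_ : _ = avg (fun t => cRe (u t * conjc (v t))))//.
rewrite [cIm (ip u v)](_ : _ = avg (fun t => cIm (u t * conjc (v t))))//.
lra.
Qed.

(* Bounded Borel functions that are boundedly almost everywhere limits of
   polynomials in [expi t]: boundary values of bounded analytic functions. *)
Definition blim b : Prop := [/\ cmeas b,
  exists c, forall t, Tdom t -> cabs (b t) <= c &
  exists (P : nat -> {poly R[i]}) (c : R),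
    (forall n t, cabs (P n).[expi t] <= c) /\
    {ae mu, forall t, Tdom t -> ccvg_seq (fun n => (P n).[expi t]) (b t)}].

Lemma ccvg_seqM (x y : nat -> R[i]) (a b : R[i]) : ccvg_seq x a -> ccvg_seq y b ->
  ccvg_seq (fun n => x n * y n) (a * b).
Proof.
move=> [x1 x2] [y1 y2]; split; rewrite ?cReM ?cImM.
  under eq_fun do rewrite cReM.
  by apply: cvgB; exact: cvgM.
under eq_fun do rewrite cImM.
by apply: cvgD; exact: cvgM.
Qed.

Lemma blim_poly p : blim (fun t => p.[expi t]).
Proof.
have [B B0 hB] := cabs_poly_bounded p.
have hb t : cabs p.[expi t] <= B by apply: hB; rewrite cabs_expi.
split; [exact: cmeas_poly|by exists B|exists (fun=> p), B; split=> //].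
by apply: ae_all => t _; split; exact: cvg_cst.
Qed.

Lemma blimM b1 b2 : blim b1 -> blim b2 -> blim (fun t => b1 t * b2 t).
Proof.
move=> [m1 [c1 h1] [P1 [d1 [e1 f1]]]] [m2 [c2 h2] [P2 [d2 [e2 f2]]]]; split.
- exact: cmeasM.
- exists (c1 * c2) => t Dt; rewrite cabsM ler_pM ?cabs_ge0 ?h1 ?h2//.
- exists (fun n => P1 n * P2 n), (d1 * d2); split.
    by move=> n t; rewrite hornerM cabsM ler_pM ?cabs_ge0.
  apply: (ae_sub (ae_and f1 f2)) => t [g1 g2] Dt.
  by under eq_fun do rewrite hornerM; exact: ccvg_seqM (g1 Dt) (g2 Dt).
Qed.

Lemma blimX b n : blim b -> blim (fun t => b t ^+ n).
Proof.
move=> hb; elim: n => [|n IH].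
  by have := blim_poly 1; under eq_fun do rewrite hornerC.
by under eq_fun do rewrite exprS; exact: blimM.
Qed.

Lemma cint_dominated (U : nat -> R -> R[i]) u (c : R) :
  (forall n, cmeas (U n)) -> cmeas u ->
  (forall n t, Tdom t -> cabs (U n t) <= c) ->
  {ae mu, forall t, Tdom t -> ccvg_seq (U ^~ t) (u t)} ->
  ccvg_seq (fun n => cint (U n)) (cint u).
Proof.
move=> mU [u1 u2] Uc Uu; split.
  have [||_] := @avg_dominated R (fun n t => cRe (U n t)) (fun t => cRe (u t)) (fun=> c)
    (fun n => (mU n).1) u1 _ (intg_cst c) => //.
    by apply: (ae_sub Uu) => t h Dt; have [] := h Dt.
  by move=> n t Dt; apply: le_trans (ler_cRe _) (Uc n t Dt).
have [||_] := @avg_dominated R (fun n t => cIm (U n t)) (fun t => cIm (u t)) (fun=> c)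
  (fun n => (mU n).2) u2 _ (intg_cst c) => //.
  by apply: (ae_sub Uu) => t h Dt; have [] := h Dt.
by move=> n t Dt; apply: le_trans (ler_cIm _) (Uc n t Dt).
Qed.

Lemma ccvg_seq_unique (x : nat -> R[i]) a a' : ccvg_seq x a -> ccvg_seq x a' -> a = a'.
Proof.
by move=> [x1 x2] [y1 y2]; apply: cRe_eq; [exact: cvg_unique x1 y1|exact: cvg_unique x2 y2].
Qed.

(** The identity holds for the approximating polynomials and passes to the limit by bounded
    convergence. *)
Lemma blim_cint b : blim b -> forall n, cint (fun t => b t * expi t ^+ n.+1) = 0.
Proof.
move=> [mb [c hc] [P [d [hP hl]]]] n.
apply: (@ccvg_seq_unique (fun k => cint (fun t => (P k).[expi t] * expi t ^+ n.+1))).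
  have mX : cmeas (fun t : R => expi t ^+ n.+1).
    have <- : (fun t => ('X^(n.+1)).[expi t]) = (fun t : R => expi t ^+ n.+1).
      by apply/funext => t; rewrite hornerXn.
    exact: cmeas_poly.
  apply: (@cint_dominated _ _ d).
  - by move=> k; apply: cmeasM => //; exact: cmeas_poly.
  - exact: cmeasM.
  - by move=> k t _; rewrite cabsM cabsX cabs_expi expr1n mulr1.
  - apply: (ae_sub hl) => t h Dt; apply: ccvg_seqM; first exact: h.
    by split; exact: cvg_cst.
under eq_fun do rewrite cint_polyX.
by split; exact: cvg_cst.
Qed.

Lemma blim_L2 b : blim b -> L2 b.
Proof. by move=> [mb [c hc] _]; exact: (L2_bounded mb hc). Qed.

Lemma blim_H2 b : blim b -> H2 b.
Proof.
move=> hb; split; first exact: blim_L2.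
move=> [//|n] _; rewrite -(blim_cint hb n).
by apply: eq_cint => t _; rewrite expiX.
Qed.

End SquareIntegrable.

(** * Fejér means *)

Section Fejer.
Context {R : realType}.
Local Notation mu := (@lebesgue_measure R).
Implicit Types (psi : R -> R) (s t : R) (j k n : nat).

(** These are the real trigonometric polynomials: conjugation leaves the real part unchanged, so
    negative frequencies are covered as well. *)
Definition analytic_re (f : R -> R) := exists p : {poly R[i]}, forall t, f t = cRe p.[expi t].

Lemma analytic_reD (f g : R -> R) : analytic_re f -> analytic_re g ->
  analytic_re (fun t => f t + g t).
Proof. by move=> [p hp] [q hq]; exists (p + q) => t; rewrite hornerD cReD hp hq. Qed.

Lemma analytic_reZ (c : R) (f : R -> R) : analytic_re f -> analytic_re (fun t => c * f t).
Proof.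
move=> [p hp]; exists (Complex c 0 *: p) => t.
by rewrite hornerZ cReM hp /= mul0r subr0.
Qed.

Lemma analytic_re_sum (I : Type) (r : seq I) (F : I -> R -> R) :
  (forall i, analytic_re (F i)) -> analytic_re (fun t => \sum_(i <- r) F i t).
Proof.
move=> hF; elim: r => [|i r IH].
  by exists 0 => t; rewrite big_nil horner0.
by under eq_fun do rewrite big_cons; exact: analytic_reD.
Qed.

Lemma expi_natM k t : expi t ^+ k = Complex (cos (k%:R * t)) (sin (k%:R * t)) :> R[i].
Proof. by rewrite -expiX. Qed.

Lemma analytic_re_cos j k : analytic_re (fun t => cos ((j%:R - k%:R) * t)).
Proof.
have H m : analytic_re (fun t => cos (m%:R * t)).
  by exists 'X^m => t; rewrite hornerXn expi_natM.
have [jk|/ltnW jk] := leqP k j.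
  by under eq_fun do rewrite -natrB//; exact: H.
by under eq_fun do rewrite -opprB mulNr cosN -natrB//; exact: H.
Qed.

Lemma analytic_re_sin j k : analytic_re (fun t => sin ((j%:R - k%:R) * t)).
Proof.
have H m : analytic_re (fun t => sin (m%:R * t)).
  (* sin (m t) is the real part of - i z^m. *)
  by exists (Complex 0 (-1) *: 'X^m) => t; rewrite hornerZ hornerXn expi_natM cReM /=; ring.
have [jk|/ltnW jk] := leqP k j.
  by under eq_fun do rewrite -natrB//; exact: H.
have := analytic_reZ (-1) (H (k - j)%N).
by under eq_fun do rewrite mulN1r -sinN -mulNr natrB// opprB.
Qed.

(** The Fejér kernel without its normalization: [n] times the usual one. Written as a squared
    modulus, it is visibly nonnegative. *)
Definition fejer n (x : R) : R := cabs (\sum_(j < n) expi x ^+ j) ^+ 2.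

Lemma fejer_ge0 n (x : R) : 0 <= fejer n x. Proof. exact: sqr_ge0. Qed.

Lemma fejerE n (x : R) :
  fejer n x = \sum_(j < n) \sum_(k < n) cos ((j%:R - k%:R) * x).
Proof.
rewrite /fejer cabs_sqr.
have -> : cRe (\sum_(j < n) expi x ^+ j) = \sum_(j < n) cos (j%:R * x).
  by elim/big_ind2 : _ => // [a b c d <- <-|i _]; rewrite ?cReD// expi_natM.
have -> : cIm (\sum_(j < n) expi x ^+ j) = \sum_(j < n) sin (j%:R * x).
  by elim/big_ind2 : _ => // [a b c d <- <-|i _]; rewrite ?cImD// expi_natM.
rewrite !expr2 !big_distrlr -big_split; apply: eq_bigr => i _.
rewrite -big_split; apply: eq_bigr => k _ /=.
by rewrite mulrBl cosB.
Qed.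

(** Summing the geometric series, the kernel times |e^(ix) - 1|^2 equals |e^(inx) - 1|^2 <= 4, while
    |e^(ix) - 1|^2 = 2 (1 - cos x). Away from its peaks the kernel is thus bounded uniformly in [n],
    hence negligible after division by [n]. *)
Lemma fejer_bound n (x : R) : fejer n x * (1 - cos x) <= 2.
Proof.
have h1 : cabs (expi x - 1) ^+ 2 = 2 * (1 - cos x).
  rewrite cabs_sqr cReD cImD cReN cImN /= oppr0 addr0.
  have := cos2Dsin2 x; nra.
have h2 : fejer n x * (2 * (1 - cos x)) = cabs (expi x ^+ n - 1) ^+ 2.
  by rewrite subrX1 cabsM exprMn h1 mulrC.
have : cabs (expi x ^+ n - 1) <= 2.
  by rewrite (le_trans (cabsB _ _))// cabsX cabs_expi expr1n cabs1.
have := cabs_ge0 (expi x ^+ n - 1).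
nra.
Qed.

Lemma fejer_continuous n : continuous (fejer n).
Proof.
rewrite (_ : fejer n = fun x => \sum_(j < n) \sum_(k < n) cos ((j%:R - k%:R) * x)); last first.
  by apply/funext => x; rewrite fejerE.
have H (F : 'I_n -> R -> R) : (forall i, continuous (F i)) ->
    continuous (fun x => \sum_(i < n) F i x).
  move=> cF; elim: (index_enum _) => [|i r IH] x.
    by under eq_fun do rewrite big_nil; exact: cvg_cst.
  by under eq_fun do rewrite big_cons; apply: cvgD; [exact: cF|exact: IH].
apply: (H (fun (j : 'I_n) x => \sum_(k < n) cos ((j%:R - k%:R) * x))) => j.
apply: (H (fun (k : 'I_n) x => cos ((j%:R - k%:R) * x))) => k x.
apply: continuous_comp; last exact: continuous_cos.
by apply: cvgM; [exact: cvg_cst|exact: cvg_id].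
Qed.

End Fejer.

Section FejerMean.
Context {R : realType}.
Local Notation mu := (@lebesgue_measure R).
Implicit Types (psi : R -> R) (s t : R) (n : nat).

(** Convolution with the kernel normalized to mean 1. At [n = 0] the value is 0, which is why the
    estimates below ask for [0 < n] or use [n.+1]. *)
Definition fejer_mean psi n t : R := n%:R^-1 * avg (fun s => psi s * fejer n (t - s)).

Lemma continuous_scale (F : R -> R) (d : R) : continuous F -> continuous (fun s => F (d * s)).
Proof.
move=> cF x; apply: (continuous_comp (f := fun s => d * s)); last exact: cF.
by apply: cvgM; [exact: cvg_cst|exact: cvg_id].
Qed.

Lemma continuous_mul (F G : R -> R) : continuous F -> continuous G ->
  continuous (fun s => F s * G s).
Proof. by move=> cF cG x; apply: cvgM; [exact: cF|exact: cG]. Qed.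

Lemma fejer_shift_continuous n t : continuous (fun s => fejer n (t - s)).
Proof.
move=> x; apply: (continuous_comp (f := fun s => t - s)); last exact: fejer_continuous.
by apply: cvgB; [exact: cvg_cst|exact: cvg_id].
Qed.

Lemma avg_sum (I : Type) (r : seq I) (F : I -> R -> R) : (forall i, intg (F i)) ->
  intg (fun t => \sum_(i <- r) F i t) /\
  avg (fun t => \sum_(i <- r) F i t) = \sum_(i <- r) avg (F i).
Proof.
move=> hF; elim: r => [|i r [IH1 IH2]].
  split; first by under eq_fun do rewrite big_nil; exact: intg_cst.
  by rewrite big_nil -[RHS](@avg_cst R); apply: eq_avg => t _; rewrite big_nil.
rewrite big_cons -IH2 -avgD//; split.
  by under eq_fun do rewrite big_cons; exact: intgD.
by apply: eq_avg => t _; rewrite big_cons.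
Qed.

(** The addition formula for the cosine separates [t] from [s], which exhibits the convolution as a
    trigonometric polynomial in [t] whose coefficients are Fourier coefficients of [psi]. *)
Lemma fejer_expand psi n t : continuous psi ->
  avg (fun s => psi s * fejer n (t - s)) =
  \sum_(j < n) \sum_(k < n)
     (avg (fun s => psi s * cos ((j%:R - k%:R) * s)) * cos ((j%:R - k%:R) * t)
    + avg (fun s => psi s * sin ((j%:R - k%:R) * s)) * sin ((j%:R - k%:R) * t)).
Proof.
move=> cpsi.
pose F (d s : R) := psi s * cos (d * (t - s)).
have hc d : intg (fun s => psi s * cos (d * s)).
  by apply/intg_continuous/continuous_mul => //; apply: continuous_scale; exact: continuous_cos.
have hs d : intg (fun s => psi s * sin (d * s)).
  by apply/intg_continuous/continuous_mul => //; apply: continuous_scale; exact: continuous_sin.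
have FE d : F d = fun s => cos (d * t) * (psi s * cos (d * s)) + sin (d * t) * (psi s * sin (d * s)).
  by apply/funext => s; rewrite /F mulrBr cosB; ring.
have hF d : intg (F d) by rewrite FE; apply: intgD; exact: intgZ.
rewrite (@eq_avg _ _ (fun s => \sum_(j < n) \sum_(k < n) F (j%:R - k%:R) s)); last first.
  move=> s _; rewrite fejerE mulr_sumr; apply: eq_bigr => j _.
  by rewrite mulr_sumr.
have H2 (j : 'I_n) := avg_sum (index_enum 'I_n) (fun k : 'I_n => hF (j%:R - k%:R)).
rewrite (avg_sum (index_enum 'I_n) (fun j : 'I_n => (H2 j).1)).2.
apply: eq_bigr => j _; rewrite (H2 j).2; apply: eq_bigr => k _.
by rewrite FE avgD; do ?exact: intgZ; rewrite !avgZ// mulrC [X in _ + X]mulrC.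
Qed.

Lemma avg_cos_diff (j k : nat) : avg (fun s => cos ((j%:R - k%:R) * s)) = (j == k)%:R :> R.
Proof.
have H m : (0 < m)%N -> avg (fun s => cos (m%:R * s)) = 0 :> R.
  by case: m => // m _; exact: avg_cos.
case: ltngtP => [jk|jk|->] /=.
- rewrite -[RHS](H (k - j)%N) ?subn_gt0//; apply: eq_avg => s _.
  by rewrite -opprB mulNr cosN natrB// ltnW.
- rewrite -[RHS](H (j - k)%N) ?subn_gt0//; apply: eq_avg => s _.
  by rewrite natrB// ltnW.
- by rewrite -[RHS](@avg_cst R); apply: eq_avg => s _; rewrite subrr mul0r cos0.
Qed.

Lemma avg_sin_diff (j k : nat) : avg (fun s => sin ((j%:R - k%:R) * s)) = 0 :> R.
Proof.
have H m : avg (fun s => sin (m%:R * s)) = 0 :> R.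
  case: m => [|m]; last exact: avg_sin.
  by rewrite -[RHS](@avg_cst R); apply: eq_avg => s _; rewrite mul0r sin0.
have hi m : intg (fun s : R => sin (m%:R * s)).
  by apply/intg_continuous/continuous_scale; exact: continuous_sin.
have [jk|/ltnW jk] := leqP k j.
  by rewrite -[RHS](H (j - k)%N); apply: eq_avg => s _; rewrite natrB.
rewrite -[RHS](mulr0 (-1)) -[X in _ = _ * X](H (k - j)%N) -avgZ//; apply: eq_avg => s _.
by rewrite -opprB mulNr sinN natrB// mulN1r.
Qed.

(** In the expansion of the constant function 1 only the [n] diagonal terms [j = k] survive, each
    contributing 1. *)
Lemma avg_fejer n t : avg (fun s => fejer n (t - s)) = n%:R :> R.
Proof.
have := @fejer_expand (fun=> 1) n t (fun x => cvg_cst _).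
under eq_avg do rewrite mul1r.
move=> ->; transitivity (\sum_(j < n) (1 : R)); last by rewrite sumr_const card_ord.
apply: eq_bigr => j _; rewrite (bigD1 j)//= big1 => [|k kj].
  under eq_avg do rewrite mul1r.
  under [X in _ + X * _ + _]eq_avg do rewrite mul1r.
  by rewrite avg_cos_diff avg_sin_diff eqxx subrr mul0r cos0 mul0r !addr0 mulr1.
under eq_avg do rewrite mul1r.
under [X in _ + X * _]eq_avg do rewrite mul1r.
rewrite avg_cos_diff avg_sin_diff (_ : _ == _ = false) ?mul0r ?addr0//.
by apply/negbTE; rewrite eq_sym.
Qed.

Lemma fejer_mean_analytic psi n : continuous psi -> analytic_re (fejer_mean psi n).
Proof.
move=> cpsi; rewrite /fejer_mean; apply: analytic_reZ.
under eq_fun do rewrite fejer_expand//.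
apply: analytic_re_sum => j; apply: analytic_re_sum => k.
by apply: analytic_reD; apply: analytic_reZ; [exact: analytic_re_cos|exact: analytic_re_sin].
Qed.

(** The normalized kernel is nonnegative with mean 1, so a Fejér mean is a weighted average of
    [psi]. With [c = 0] this is what keeps Re S nonpositive later. *)
Lemma fejer_mean_le psi (c : R) n t : continuous psi -> (forall s, Tdom s -> psi s <= c) ->
  (0 < n)%N -> fejer_mean psi n t <= c.
Proof.
move=> cpsi hc n0; rewrite /fejer_mean mulrC ler_pdivrMr ?ltr0n//.
have hF := intg_continuous (@fejer_shift_continuous n t).
rewrite -(avg_fejer n t) -avgZ//; apply: avg_le; last first.
- by move=> s Ds; rewrite ler_wpM2r ?fejer_ge0 ?hc.
- exact: intgZ.
- by apply/intg_continuous/continuous_mul => //; exact: fejer_shift_continuous.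
Qed.

Lemma fejer_meanN psi n t : continuous psi -> fejer_mean (fun s => - psi s) n t = - fejer_mean psi n t.
Proof.
move=> cpsi; rewrite /fejer_mean -mulrN; congr (_ * _); rewrite -mulN1r -avgZ.
  by apply: eq_avg => s _; rewrite mulNr mulN1r.
by apply/intg_continuous/continuous_mul => //; exact: fejer_shift_continuous.
Qed.

Lemma fejer_mean_bound psi (c : R) n t : continuous psi -> (forall s, Tdom s -> `|psi s| <= c) ->
  (0 < n)%N -> `|fejer_mean psi n t| <= c.
Proof.
move=> cpsi hc n0; rewrite ler_norml; apply/andP; split.
  rewrite lerNl -fejer_meanN//; apply: fejer_mean_le => //.
    by move=> x; apply: cvgN; exact: cpsi.
  by move=> s Ds; rewrite (le_trans _ (hc s Ds))// -normrN ler_norm.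
by apply: fejer_mean_le => // s Ds; rewrite (le_trans _ (hc s Ds))// ler_norm.
Qed.

End FejerMean.

(** * Pointwise convergence of Fejér means *)

Section FejerConvergence.
Context {R : realType}.
Local Notation mu := (@lebesgue_measure R).
Implicit Types (psi rho : R -> R) (s t : R) (n : nat).

Lemma TdomP s : Tdom s <-> 0 <= s <= 2 * pi.
Proof. by rewrite /Tdom /= in_itv. Qed.

(** The difference of two points of [0, 2 pi] may come close to 0 but also to 2 pi or - 2 pi, where
    the kernel peaks again; both dangers are excluded. *)
Lemma cos_le_of_dist (d x : R) : 0 < d -> d <= `|x| -> `|x| <= 2 * pi - d ->
  cos x <= cos d.
Proof.
move=> d0 dx xd; rewrite -(cos_norm x).
have dpi : d <= pi by lra.
have pi0 : 0 <= pi :> R by exact: pi_ge0.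
have din : d \in `[0, pi] by rewrite in_itv /= (ltW d0).
have [xpi|pix] := leP `|x| pi.
  by rewrite leNgt ltr_cos ?in_itv /= ?normr_ge0 ?xpi ?(ltW d0)// -leNgt.
have -> : cos `|x| = cos (2 * pi - `|x|).
  by rewrite mulr_natl -[in RHS]cosN opprB cosB cos2pi sin2pi mulr1 mulr0 addr0.
rewrite leNgt ltr_cos//; first by rewrite -leNgt; lra.
by rewrite in_itv /=; apply/andP; split; lra.
Qed.

(** Within distance [d] of [t] continuity gives the error [eps]; farther away the kernel is bounded
    by a constant, which contributes [C / n]. *)
Lemma fejer_mean_dist psi (B t eps : R) : continuous psi ->
  (forall s, Tdom s -> `|psi s| <= B) -> 0 < t < 2 * pi -> 0 < eps ->
  exists C, forall n, (0 < n)%N -> `|fejer_mean psi n t - psi t| <= eps + C / n%:R.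
Proof.
move=> cpsi hB /andP[t0 t2] e0.
have Dt : Tdom t by apply/TdomP; rewrite !ltW.
have /cvgrPdist_lt/(_ _ e0)/nbhs_ballP[d0 /= d00 hd0] := cpsi t.
(* As [psi] is not assumed periodic, the bounds by [t] and [2 * pi - t] are imposed so that
   [|t - s| <= 2 * pi - d] for every [s] in the period. *)
pose d := Num.min d0 (Num.min t (2 * pi - t)).
have dd : 0 < d by rewrite !lt_min d00 t0 subr_gt0.
have hdt : d <= t by rewrite /d !ge_min lexx orbT.
have hd2 : d <= 2 * pi - t by rewrite /d !ge_min lexx !orbT.
have hdd : d <= d0 by rewrite /d ge_min lexx.
have k0 : 0 < 1 - cos d.
  rewrite subr_gt0 -[ltRHS](@cos0 R) ltr_cos ?in_itv /= ?lexx ?pi_ge0//.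
  by apply/andP; split; lra.
have B0 : 0 <= B by rewrite (le_trans _ (hB t Dt)).
exists (2 * B * (2 / (1 - cos d))) => n n0.
have nR : 0 < n%:R :> R by rewrite ltr0n.
have hF := intg_continuous (@fejer_shift_continuous R n t).
have hpF : intg (fun s => psi s * fejer n (t - s)).
  by apply/intg_continuous/continuous_mul => //; exact: fejer_shift_continuous.
have hi : intg (fun s => psi s * fejer n (t - s) - psi t * fejer n (t - s)).
  by apply: intgB => //; exact: intgZ.
have -> : fejer_mean psi n t - psi t =
    n%:R^-1 * avg (fun s => psi s * fejer n (t - s) - psi t * fejer n (t - s)).
  rewrite avgB//; last exact: intgZ.
  by rewrite avgZ// avg_fejer /fejer_mean; field; rewrite gt_eqF.
rewrite normrM gtr0_norm ?invr_gt0// mulrC ler_pdivrMr// mulrDl divfK ?gt_eqF//.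
apply: (le_trans (ler_norm_avg hi)).
rewrite -[in leRHS](avg_fejer n t) -avgZ// -[X in _ + X](@avg_cst R) -avgD; last 2 first.
- exact: intgZ.
- exact: intg_cst.
apply: avg_le; first exact: intg_norm.
  by apply: intgD; [exact: intgZ|exact: intg_cst].
move=> s Ds; rewrite -mulrBl normrM (ger0_norm (fejer_ge0 _ _)).
have F0 := fejer_ge0 n (t - s).
have [st|st] := ltP `|t - s| d.
  have h : `|psi s - psi t| <= eps.
    by rewrite distrC ltW//; apply: hd0; rewrite /ball /= (lt_le_trans st).
  by rewrite (le_trans (ler_wpM2r F0 h))// lerDl !mulr_ge0// invr_ge0 ltW.
have h1 : `|psi s - psi t| <= 2 * B.
  by rewrite (le_trans (ler_normB _ _))// mulr_natl mulr2n lerD// hB.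
have h2 : cos (t - s) <= cos d.
  apply: cos_le_of_dist => //; move/TdomP : Ds => /andP[s0 s2].
  by rewrite ler_norml; apply/andP; split; lra.
have h3 : fejer n (t - s) <= 2 / (1 - cos d).
  rewrite ler_pdivlMr// (le_trans _ (fejer_bound n (t - s)))// ler_wpM2l//.
  by lra.
by rewrite (le_trans (ler_pM _ _ h1 h3))// lerDr mulr_ge0// ltW.
Qed.

Lemma fejer_mean_cvg psi (B t : R) : continuous psi ->
  (forall s, Tdom s -> `|psi s| <= B) -> 0 < t < 2 * pi ->
  fejer_mean psi n.+1 t @[n --> \oo] --> psi t.
Proof.
move=> cpsi hB ht; apply/cvgrPdist_le => e e0.
have [C hC] := fejer_mean_dist cpsi hB ht (divr_gt0 e0 (@ltr0n R 2)).
have hc : C / n.+1%:R @[n --> \oo] --> 0.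
  rewrite -(mulr0 C); apply: cvgM; first exact: cvg_cst.
  exact: cvg_harmonic.
have /cvgrPdist_le/(_ _ (divr_gt0 e0 (@ltr0n R 2))) := hc.
apply: filterS => n; rewrite sub0r normrN => h.
by rewrite distrC (le_trans (hC n.+1 isT))// [leRHS](splitr e) lerD2l (le_trans _ h)// ler_norm.
Qed.

Lemma ae_interior (P : R -> Prop) : (forall t, 0 < t < 2 * pi -> P t) ->
  {ae mu, forall t, Tdom t -> P t}.
Proof.
move=> h; exists [set 0; 2 * pi]; split.
- exact: measurableU.
- by apply: null_set_setU => //; exact: lebesgue_measure_set1.
- move=> t /not_implyP[/TdomP /andP[t0 t2] nP].
  have [->|t0'] := eqVneq t 0; first by left.
  have [->|t2'] := eqVneq t (2 * pi); first by right.
  by exfalso; apply/nP/h; rewrite !lt_neqAle t0 t2 t2' eq_sym t0'.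
Qed.

Lemma continuous_bounded_Tdom psi : continuous psi ->
  exists B, forall s, Tdom s -> `|psi s| <= B.
Proof.
move=> cpsi.
have /compact_bounded[M [_ hM]] := continuous_compact (continuous_subspaceT cpsi)
  (@segment_compact R 0 (2 * pi)).
by exists (`|M| + 1) => s Ds; apply: (hM (`|M| + 1)); [rewrite ltr_pwDr// ler_norm|exists s].
Qed.

End FejerConvergence.

(** * Density of trigonometric polynomials in mean *)

Section Density.
Context {R : realType}.
Local Notation mu := (@lebesgue_measure R).
Implicit Types (psi rho : R -> R) (s t : R) (n : nat).

Lemma continuous_L1_dense rho (eps : R) : intg rho -> 0 < eps ->
  exists psi, continuous psi /\ avg (fun t => `|rho t - psi t|) < eps.
Proof.
move=> hrho e0.
have [g [gc gi]] := approximation_continuous_integrable (@measurable_Tdom R) mu_Tdom_lty hrho.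
have e1 : 0 < eps * (2 * pi) by rewrite mulr_gt0// twopi_gt0.
move/fine_cvgP => [_ /cvgrPdist_lt/(_ _ e1)].
case=> N _ /(_ N (leqnn N)) /=; rewrite sub0r normrN => h.
exists (g N); split; first exact: gc.
rewrite /avg mulrC ltr_pdivrMr ?twopi_gt0// (le_lt_trans _ h)//.
rewrite -[X in _ <= `|X|]/(Rintegral mu Tdom (fun t => `|rho t - g N t|)).
exact: ler_norm.
Qed.

(** Fejér means extend the orthogonality from trigonometric polynomials to continuous functions;
    testing against a continuous substitute for the sign of [rho] then recovers the mean of
    [|rho|]. *)
Lemma avg_trig_eq0 rho : intg rho ->
  (forall p : {poly R[i]}, avg (fun t => rho t * cRe p.[expi t]) = 0) ->
  {ae mu, forall t, Tdom t -> rho t = 0}.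
Proof.
move=> hrho h0; apply: avg_abs_eq0 => //.
have hc psi (B : R) : continuous psi -> (forall s, Tdom s -> `|psi s| <= B) ->
    intg (fun t => rho t * psi t) /\ avg (fun t => rho t * psi t) = 0.
  move=> cpsi hB.
  have mrho := intg_measurable hrho.
  have [|||||hi hl] := @avg_dominated R (fun n t => rho t * fejer_mean psi n.+1 t)
    (fun t => rho t * psi t) (fun t => B * `|rho t|).
  - move=> n; apply: measurable_funM => //.
    have [p hp] := fejer_mean_analytic n.+1 cpsi.
    rewrite (_ : fejer_mean psi n.+1 = fun t => cRe p.[expi t]); last exact/funext.
    exact: (cmeas_poly _).1.
  - by apply: measurable_funM => //; exact: continuous_measurable_Tdom.
  - apply: ae_interior => t ht; apply: cvgM; first exact: cvg_cst.
    exact: fejer_mean_cvg cpsi hB ht.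
  - by apply: intgZ; exact: intg_norm.
  - by move=> n t Dt; rewrite normrM mulrC ler_wpM2r// fejer_mean_bound.
  split=> //; have hl0 n : avg (fun t => rho t * fejer_mean psi n.+1 t) = 0.
    have [p hp] := fejer_mean_analytic n.+1 cpsi.
    by rewrite -[RHS](h0 p); apply: eq_avg => t _; rewrite hp.
  have hl1 : avg (fun t => rho t * fejer_mean psi n.+1 t) @[n --> \oo] --> (0 : R).
    by under eq_fun do rewrite hl0; exact: cvg_cst.
  exact: cvg_unique hl hl1.
apply/eqP; rewrite eq_le avg_ge0 ?andbT; last by move=> t _.
apply/ler_addgt0Pr => e e0; rewrite add0r.
pose d := e / 3; have d0 : 0 < d by rewrite divr_gt0.
have [psi [cpsi hpsi]] := continuous_L1_dense hrho d0.
(* A continuous approximate sign of [psi]: it is bounded by 1 and satisfies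
   [psi * phi >= |psi| - d]. *)
pose phi t := psi t / (d + `|psi t|).
have den t : 0 < d + `|psi t| by rewrite ltr_pwDl.
have cphi : continuous phi.
  move=> x; apply: cvgM; first exact: cpsi.
  apply: cvgV; first by rewrite gt_eqF.
  by apply: cvgD; [exact: cvg_cst|apply: cvg_norm; exact: cpsi].
have phi1 t : `|phi t| <= 1.
  by rewrite normrM normfV (gtr0_norm (den t)) ler_pdivrMr// mul1r lerDr ltW.
have [i1 a1] := hc _ 1 cphi (fun t _ => phi1 t).
have i2 : intg (fun t => `|rho t - psi t|).
  by apply/intg_norm/intgB => //; exact: intg_continuous.
(* On average the first term vanishes and the others amount to less than 2 d + d = e. *)
have H t : `|rho t| <= rho t * phi t + (2 * `|rho t - psi t| + d).
  have h1 : `|psi t| - d <= psi t * phi t.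
    rewrite /phi mulrA -expr2 -(real_normK (num_real (psi t))) ler_pdivlMr//.
    by rewrite -subr_ge0; have := sqr_ge0 d; nra.
  have h2 : `|(psi t - rho t) * phi t| <= `|rho t - psi t|.
    by rewrite normrM distrC -[leRHS]mulr1 ler_pM.
  have h3 : `|rho t| <= `|psi t| + `|rho t - psi t|.
    by rewrite -[X in `|X| <= _](subrKC (psi t)) ler_normD.
  move: h2; rewrite ler_norml mulrBl => /andP[h2 h4].
  lra.
rewrite (le_trans (avg_le _ _ (fun t _ => H t)))//.
- exact: intg_norm.
- by do 2?[apply: intgD => //]; [exact: intgZ|exact: intg_cst].
rewrite avgD//; last by apply: intgD; [exact: intgZ|exact: intg_cst].
rewrite a1 add0r avgD; [|exact: intgZ|exact: intg_cst].
by rewrite avgZ// avg_cst; move: hpsi; rewrite /d; lra.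
Qed.

(** Approximate by a continuous function, truncate it at 0, and take a Fejér mean: the last two
    operations respect the sign, and each of the two approximations costs [eps / 2]. *)
Lemma trig_L1_dense rho (eps : R) : intg rho -> (forall t, Tdom t -> rho t <= 0) ->
  0 < eps -> exists p : {poly R[i]},
    (forall t, cRe p.[expi t] <= 0) /\ avg (fun t => `|rho t - cRe p.[expi t]|) <= eps.
Proof.
move=> hrho rho0 e0.
have e2 : 0 < eps / 2 by rewrite divr_gt0.
have [g [cg hg]] := continuous_L1_dense hrho e2.
(* This is min (g, 0); since [rho] is nonpositive, the truncation does not increase the distance to
   it. *)
pose psi t := 2^-1 * (g t - `|g t|).
have cpsi : continuous psi.
  move=> x; apply: cvgM; first exact: cvg_cst.
  by apply: cvgB; [exact: cg|apply: cvg_norm; exact: cg].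
have psi0 t : psi t <= 0.
  by rewrite /psi; have := ler_norm (g t); lra.
have hpsi t : Tdom t -> `|rho t - psi t| <= `|rho t - g t|.
  move=> Dt; have := rho0 t Dt; rewrite /psi.
  have [g0|g0] := leP 0 (g t).
    rewrite (ger0_norm g0) subrr mulr0 subr0 => r0.
    by rewrite !ler0_norm; lra.
  rewrite (ltr0_norm g0) => r0.
  by rewrite (_ : 2^-1 * (g t - - g t) = g t)//; field.
have [B hB] := continuous_bounded_Tdom cpsi.
have ipsi := intg_continuous cpsi.
have ifm n : intg (fejer_mean psi n).
  have [p hp] := fejer_mean_analytic n cpsi.
  rewrite (_ : fejer_mean psi n = fun t => cRe p.[expi t]); last exact/funext.
  exact: (cintg_poly _).1.
have [|||||_ hl] := @avg_dominated R (fun n t => `|psi t - fejer_mean psi n.+1 t|) (fun=> 0) (fun=> 2 * B).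
- by move=> n; apply: intg_measurable; apply/intg_norm/intgB.
- exact: measurable_cst.
- apply: ae_interior => t ht; rewrite -(normr0 R) -(subrr (psi t)).
  apply: cvg_norm; apply: cvgB; first exact: cvg_cst.
  exact: fejer_mean_cvg cpsi hB ht.
- exact: intg_cst.
- move=> n t Dt; rewrite normr_id (le_trans (ler_normB _ _))// mulr_natl mulr2n.
  by rewrite lerD ?hB// fejer_mean_bound.
move: hl; rewrite avg_cst => /cvgrPdist_le/(_ _ e2)[N _ /(_ N (leqnn N)) /=].
rewrite sub0r normrN => /(le_trans (ler_norm _)) hN.
have [p hp] := fejer_mean_analytic N.+1 cpsi.
exists p; split=> [t|]; first by rewrite -hp fejer_mean_le.
rewrite [leRHS]splitr (le_trans _ (lerD (ltW hg) hN))//.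
rewrite -avgD; last 2 first.
- by apply/intg_norm/intgB => //; exact: intg_continuous.
- by apply/intg_norm/intgB.
apply: avg_le.
- by apply/intg_norm/intgB => //; exact: (cintg_poly _).1.
- by apply: intgD; apply/intg_norm/intgB => //; exact: intg_continuous.
- move=> t Dt; rewrite -hp (le_trans (ler_distD (psi t) _ _))// lerD2r; exact: hpsi.
Qed.

End Density.

(** * Uniqueness of Fourier coefficients *)

Section FourierUniqueness.
Context {R : realType}.
Local Notation mu := (@lebesgue_measure R).
Implicit Types (f v : R -> R[i]) (p : {poly R[i]}).

Lemma L2_poly p : L2 (fun t => p.[expi t]).
Proof. exact/blim_L2/blim_poly. Qed.

Lemma L2_conj v : L2 v -> L2 (fun t => conjc (v t)).
Proof.
move=> hv; have [m1 m2] := cmeasJ (L2_cmeas hv); split=> //; split=> //.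
by under eq_fun do rewrite cabsJ; exact: L2_intg_sqr.
Qed.

(** The induction is on the polynomial times [X^n] for all [n], so that the Horner step only raises
    [n]. *)
Lemma ip_poly_eq0 v : L2 v -> (forall n, cint (fun t => expi t ^+ n * conjc (v t)) = 0) ->
  forall p, cint (fun t => p.[expi t] * conjc (v t)) = 0.
Proof.
move=> hv h p.
suff H n : cint (fun t => (p * 'X^n).[expi t] * conjc (v t)) = 0.
  by rewrite -(H 0%N); apply: eq_cint => t _; rewrite expr0 mulr1.
elim/poly_ind: p n => [|p c IH] n.
  by rewrite -(cint_cst 0); apply: eq_cint => t _; rewrite mul0r horner0 mul0r.
have hX : cintg (fun t => ('X^n).[expi t] * conjc (v t)).
  by apply: cintg_ip => //; exact: L2_poly.
rewrite (@eq_cint _ _ (fun t => (p * 'X^(n.+1)).[expi t] * conjc (v t) +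
    c * (('X^n).[expi t] * conjc (v t)))); last first.
  by move=> t _; rewrite !(hornerM, hornerD, hornerC, hornerX, hornerXn) exprS; ring.
rewrite cintD; first last.
- exact: cintgZ.
- by apply: cintg_ip => //; exact: L2_poly.
rewrite IH cintZ// add0r -[RHS](mulr0 c) -[in RHS](h n); congr (_ * _).
by apply: eq_cint => t _; rewrite hornerXn.
Qed.

(** If all coefficients of nonnegative index vanish, then, those of negative index vanishing
    already, the real and imaginary parts of [f] are orthogonal to all trigonometric polynomials. *)
Lemma H2_coef_neq0 f : H2 f -> ~ {ae mu, forall t, Tdom t -> f t = 0} ->
  exists j, ip (fun t => expi t ^+ j) f <> 0.
Proof.
move=> [fL2 fH] fn0; apply: contrapT => hn; apply: fn0.
have h0 j : cint (fun t => expi t ^+ j * conjc (f t)) = 0.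
  by apply: contrapT => hj; apply: hn; exists j.
have [i1 i2] : intg (fun t => cRe (f t)) /\ intg (fun t => cIm (f t)).
  have [i1 i2] := cintg_ip (L2_poly 1) (L2_conj fL2).
  by split; [move: i1|move: i2]; under eq_fun do rewrite hornerC mul1r conjcK.
(* For positive [j] this is membership in [H2]; for [j = 0] it is the conjugate of [h0 0]. *)
have h0' j : cint (fun t => expi t ^+ j * conjc (conjc (f t))) = 0.
  case: j => [|j]; last first.
    rewrite -(fH j.+1 isT); apply: eq_cint => t _.
    by rewrite conjcK mulrC expiX.
  have [e1 e2] := h0 0%N; apply: cRe_eq => /=.
    by rewrite -[RHS]e1; apply: eq_avg => t _; rewrite !expr0 !mul1r conjcK cReJ.
  rewrite -[LHS]/(avg _) -(mulr0 (-1)) -[X in _ = _ * X]e2 -[X in _ = _ * X]/(avg _).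
  rewrite -avgZ; last by under eq_fun do rewrite expr0 mul1r cImJ; exact: intgN.
  by apply: eq_avg => t _; rewrite !expr0 !mul1r conjcK cImJ mulN1r opprK.
have hp p := ip_poly_eq0 fL2 h0 p.
have hp' p := ip_poly_eq0 (L2_conj fL2) h0' p.
(* Re (p conj f) + Re (p f) = 2 Re p Re f; for [him], Im (p f) - Im (p conj f) = 2 Re p Im f. *)
have hre p : avg (fun t => cRe (f t) * cRe p.[expi t]) = 0.
  have [e1 _] := hp p; have [e2 _] := hp' p.
  have [j1 _] := cintg_ip (L2_poly p) fL2; have [j2 _] := cintg_ip (L2_poly p) (L2_conj fL2).
  have : avg (fun t => cRe (p.[expi t] * conjc (f t)) + cRe (p.[expi t] * conjc (conjc (f t)))) = 0.
    by rewrite avgD// [X in X + _]e1 [X in _ + X]e2 addr0.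
  move=> e; rewrite -(mulr0 2^-1) -[X in _ = _ * X]e -avgZ; last exact: intgD.
  by apply: eq_avg => t _; rewrite !cReM !cReJ !cImJ; field.
have him p : avg (fun t => cIm (f t) * cRe p.[expi t]) = 0.
  have [_ e1] := hp p; have [_ e2] := hp' p.
  have [_ j1] := cintg_ip (L2_poly p) fL2; have [_ j2] := cintg_ip (L2_poly p) (L2_conj fL2).
  have : avg (fun t => cIm (p.[expi t] * conjc (conjc (f t))) - cIm (p.[expi t] * conjc (f t))) = 0.
    by rewrite avgB// [X in X - _]e2 [X in _ - X]e1 subr0.
  move=> e; rewrite -(mulr0 2^-1) -[X in _ = _ * X]e -avgZ; last exact: intgB.
  by apply: eq_avg => t _; rewrite !cImM !cReJ !cImJ; field.
apply: (ae_sub (ae_and (avg_trig_eq0 i1 hre) (avg_trig_eq0 i2 him))) => t [h1 h2] Dt.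
by apply: cRe_eq; [exact: h1|exact: h2].
Qed.

End FourierUniqueness.

(** * Almost outer polynomials *)

Section AlmostOuter.
Context {R : realType}.
Local Notation mu := (@lebesgue_measure R).
Implicit Types (xi sigma : R -> R) (p : {poly R[i]}).

Lemma bernoulli_ineq (x : R) n : -1 <= x -> 1 + n%:R * x <= (1 + x) ^+ n.
Proof.
move=> x1; elim: n => [|n IH]; first by rewrite mul0r addr0.
rewrite exprSr -natr1 mulrDl mul1r.
have h : 0 <= 1 + x by lra.
rewrite (le_trans _ (ler_wpM2r h IH))//.
have := mulr_ge0 (ler0n R n) (sqr_ge0 x); nra.
Qed.

(** If [b < a], then e^b >= e^a (1 + b - a) and e^a <= 1. With no lower bound on [a] or [b],
    closeness in mean of exponents thus yields a comparison in mean of exponentials. *)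
Lemma expR_sub_le (a b : R) : a <= 0 -> expR a <= expR b + `|b - a|.
Proof.
move=> a0; have [ab|ba] := leP a b.
  by rewrite (le_trans (_ : _ <= expR b))// ?lerDl// ler_expR.
rewrite ltr0_norm ?subr_lt0//.
have h1 := expR_ge1Dx (b - a).
have h2 : expR b = expR a * expR (b - a) by rewrite -expRD; congr expR; ring.
have h3 : expR a <= 1 by rewrite -[leRHS]expR0 ler_expR.
have := expR_ge0 a; nra.
Qed.

Lemma Complex_real_exp (r : R) n : Complex r 0 ^+ n = Complex (r ^+ n) 0 :> R[i].
Proof.
elim: n => [//|n IH]; rewrite !exprS IH; apply: cRe_eq; rewrite ?cReM ?cImM /=; ring.
Qed.

(** Expand the square; the cross term is a mean of Re p, which the mean value property evaluates at
    0. *)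
Lemma avg_sub_one p : sqn (fun t => p.[expi t] - 1) =
  sqn (fun t => p.[expi t]) + 1 - 2 * cRe p.[0].
Proof.
have i1 := L2_intg_sqr (L2_poly p); have [i2 _] := @cintg_poly R p.
rewrite -cint_poly -[X in _ - _ * X]/(avg _) -[X in _ + X - _](@avg_cst R) /sqn.
rewrite -avgZ// -avgD//; last exact: intg_cst.
rewrite -avgB; [|by apply: intgD => //; exact: intg_cst|exact: intgZ].
by apply: eq_avg => t _; rewrite !cabs_sqr cReD cImD cReN cImN /=; ring.
Qed.

(* A polynomial substitute for the outer function [exp (S / 2)], where [S] is a
   polynomial with [Re S] close to [xi]: [(1 + S / 2N) ^ N] for large [N]. *)
Lemma almost_outer xi (eps : R) : intg xi -> (forall t, Tdom t -> xi t <= 0) -> 0 < eps ->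
  exists p, sqn (fun t => p.[expi t] - 1) <= avg (fun t => `|xi t|) + 2 * eps /\
    forall b : R -> R, measurable_fun Tdom b -> (forall t, Tdom t -> 0 <= b t <= 1) ->
      avg (fun t => b t * cabs p.[expi t] ^+ 2) <= avg (fun t => b t * expR (xi t)) + 2 * eps.
Proof.
move=> ixi xi0 e0.
have [p0 [sig0 hsig]] := trig_L1_dense ixi xi0 e0.
(* Removing an imaginary constant makes [S.[0]] real, equal to the mean [s0] of Re S, without
   altering Re S. *)
pose S := p0 - (Complex 0 (cIm p0.[0]))%:P.
pose sig t := cRe p0.[expi t].
have Ssig t : cRe S.[expi t] = sig t.
  by rewrite !hornerE cReD cReN /= oppr0 addr0.
have isig : intg sig by exact: (cintg_poly _).1.
pose s0 := avg sig.
have S0 : S.[0] = Complex s0 0.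
  rewrite /s0 -[avg sig]/(cRe (cint (fun t => p0.[expi t]))) cint_poly.
  by apply: cRe_eq; rewrite !hornerE ?cReD ?cImD /= ?oppr0 ?addr0 ?subrr.
have s0le : - s0 <= avg (fun t => `|xi t|) + eps.
  have hi : intg (fun t => `|xi t - sig t|) by exact/intg_norm/intgB.
  have := lerD (lexx (avg (fun t => `|xi t|))) hsig.
  rewrite -avgD//; last exact: intg_norm.
  apply: le_trans; rewrite /s0 -mulN1r -avgZ//; apply: avg_le.
  - exact: intgZ.
  - by apply: intgD => //; exact: intg_norm.
  - move=> t _; rewrite mulN1r; have := ler_norm (- xi t); have := ler_norm (xi t - sig t).
    by rewrite normrN; lra.
have [B B0 hB] := cabs_poly_bounded S.
have l0 : 0 < ln (1 + eps) by rewrite ln_gt0// ltrDl.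
(* The first summand makes the second-order error exp (B^2 / 4N) at most [1 + eps]; the second keeps
   [s0 / 2N] above -1, as Bernoulli's inequality requires. *)
pose M := B ^+ 2 / (4 * ln (1 + eps)) + `|s0|.
have M0 : 0 <= M by rewrite addr_ge0// divr_ge0 ?sqr_ge0// mulr_ge0// ltW.
have [N [N0 hN]] : exists N, (0 < N)%N /\ M <= N%:R.
  exists (Num.Def.archi_bound M).+1; split=> //.
  by rewrite ltW// (lt_trans (archi_boundP M0))// ltr_nat.
have NR : 0 < N%:R :> R by rewrite ltr0n.
have hN1 : B ^+ 2 / (4 * N%:R) <= ln (1 + eps).
  rewrite ler_pdivrMr ?mulr_gt0//.
  have : B ^+ 2 / (4 * ln (1 + eps)) <= N%:R by rewrite (le_trans _ hN)// lerDl.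
  by rewrite ler_pdivrMr ?mulr_gt0//; lra.
have hN2 : `|s0| <= N%:R.
  by rewrite (le_trans _ hN)// lerDr divr_ge0 ?sqr_ge0// mulr_ge0// ltW.
pose c : R := (2 * N%:R)^-1.
have c0 : 0 < c by rewrite invr_gt0 mulr_gt0.
pose p := (1 + Complex c 0 *: S) ^+ N.
have pE z : p.[z] = (1 + Complex c 0 * S.[z]) ^+ N by rewrite /p !hornerE.
(* With c = 1/2N, |1 + c S|^2 = 1 + Re S / N + c^2 |S|^2, at most the exponential of Re S / N + c^2
   B^2; the N-th power gives the claim because e^(Re S) <= 1. *)
have p_le t : cabs p.[expi t] ^+ 2 <= expR (sig t) + eps.
  rewrite pE cabsX -exprM mulnC exprM.
  have -> : cabs (1 + Complex c 0 * S.[expi t]) ^+ 2 =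
      1 + (sig t / N%:R + c ^+ 2 * cabs S.[expi t] ^+ 2).
    rewrite !cabs_sqr -Ssig cReD cImD cReM cImM /= /c; field; exact: lt0r_neq0.
  have hx : 1 + (sig t / N%:R + c ^+ 2 * cabs S.[expi t] ^+ 2) <=
      expR (sig t / N%:R + c ^+ 2 * B ^+ 2).
    apply: le_trans (expR_ge1Dx _) _; rewrite ler_expR lerD2l ler_wpM2l ?sqr_ge0//.
    by rewrite lerXn2r ?nnegrE ?cabs_ge0// hB// cabs_expi.
  have hx0 : 0 <= 1 + (sig t / N%:R + c ^+ 2 * cabs S.[expi t] ^+ 2).
    rewrite (_ : 1 + _ = cabs (1 + Complex c 0 * S.[expi t]) ^+ 2) ?sqr_ge0//.
    rewrite !cabs_sqr -Ssig cReD cImD cReM cImM /= /c; field; exact: lt0r_neq0.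
  rewrite (le_trans (lerXn2r _ _ _ hx)) ?nnegrE ?expR_ge0//.
  rewrite -expRM_natl mulr_natl (_ : _ *+ N = sig t + B ^+ 2 / (4 * N%:R)); last first.
    by rewrite -mulr_natl /c; field; exact: lt0r_neq0.
  rewrite expRD.
  have h1 : expR (sig t) <= 1 by rewrite -[leRHS]expR0 ler_expR sig0.
  have h2 : expR (B ^+ 2 / (4 * N%:R)) <= 1 + eps.
    rewrite -[leRHS]lnK ?ler_expR// posrE; lra.
  have := ler_wpM2l (expR_ge0 (sig t)) h2; have := expR_ge0 (sig t); nra.
(* Bernoulli's inequality for [p.[0]], which is the real number (1 + s0 / 2N)^N. *)
have p0le : 1 + s0 / 2 <= cRe p.[0].
  rewrite pE S0 (_ : 1 + _ = Complex (1 + c * s0) 0); last first.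
    by apply: cRe_eq; rewrite ?cReD ?cImD ?cReM ?cImM /=; ring.
  rewrite Complex_real_exp /=; apply: le_trans (bernoulli_ineq N _).
    by rewrite /c lerD2l le_eqVlt; apply/orP; left; apply/eqP; field; exact: lt0r_neq0.
  have : - N%:R <= s0 by move: hN2; rewrite ler_norml => /andP[].
  rewrite /c mulrC ler_pdivlMr ?mulr_gt0//; have := NR; lra.
have ip2 := L2_intg_sqr (L2_poly p).
exists p; split.
  have h : sqn (fun t => p.[expi t]) <= 1 + eps.
    rewrite -[leRHS](@avg_cst R); apply: avg_le => //; first exact: intg_cst.
    move=> t _; apply: le_trans (p_le t) _; rewrite lerD2r -[leRHS]expR0 ler_expR.
    exact: sig0.
  (* The bound is (1 + eps) + 1 - 2 (1 + s0 / 2) = eps - s0, and [s0le] controls [- s0]. *)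
  rewrite avg_sub_one; lra.
move=> b mb hb.
have ib F : intg F -> intg (fun t => b t * F t).
  move=> hF; apply: (intg_le _ (intg_norm hF)).
    by apply: measurable_funM => //; exact: intg_measurable.
  move=> t /hb/andP[b0 b1]; rewrite normrM ger0_norm// -[leRHS]mul1r ler_wpM2r//.
have iexp : intg (fun t => expR (xi t)).
  apply: (@intg_bounded _ _ 1).
    by apply: measurableT_comp; [exact: measurable_expR|exact: intg_measurable].
  by move=> t Dt; rewrite ger0_norm ?expR_ge0// -[leRHS]expR0 ler_expR xi0.
have hi : intg (fun t => `|xi t - sig t|) by exact/intg_norm/intgB.
have : avg (fun t => b t * cabs p.[expi t] ^+ 2) <=
    avg (fun t => b t * expR (xi t) + (`|xi t - sig t| + eps)).
  apply: avg_le; first exact: ib.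
    by apply: intgD; [exact: ib|apply: intgD => //; exact: intg_cst].
  move=> t Dt; have /andP[b0 b1] := hb t Dt.
  have h1 := p_le t; have h2 := @expR_sub_le (sig t) (xi t) (sig0 t).
  have h3 := normr_ge0 (xi t - sig t).
  have h4 := ler_wpM2l b0 (le_trans h1 (lerD h2 (lexx eps))).
  have h5 : b t * (`|xi t - sig t| + eps) <= `|xi t - sig t| + eps.
    by rewrite -[leRHS]mul1r ler_wpM2r// addr_ge0// ltW.
  lra.
rewrite avgD; [|exact: ib|by apply: intgD => //; exact: intg_cst].
rewrite avgD//; last exact: intg_cst.
rewrite avg_cst; move: hsig; rewrite -/sig.
lra.
Qed.

End AlmostOuter.

(** * Boundary values *)

Section PolynomialApproximation.
Context {R : realType}.
Local Notation mu := (@lebesgue_measure R).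
Implicit Types (G : R[i] -> R[i]) (p q : {poly R[i]}) (x y : nat -> R[i]).

Lemma ccvg_seqP x (a : R[i]) : ccvg_seq x a <-> cabs (x n - a) @[n --> \oo] --> 0.
Proof.
split=> [[h1 h2]|h].
  have h3 : `|cRe (x n - a)| + `|cIm (x n - a)| @[n --> \oo] --> 0.
    have k1 : cRe (x n) - cRe a @[n --> \oo] --> 0.
      by rewrite -(subrr (cRe a)); apply: cvgB => //; exact: cvg_cst.
    have k2 : cIm (x n) - cIm a @[n --> \oo] --> 0.
      by rewrite -(subrr (cIm a)); apply: cvgB => //; exact: cvg_cst.
    under eq_fun do rewrite cReD cReN cImD cImN.
    have := cvgD (cvg_norm k1) (cvg_norm k2); rewrite normr0 addr0; exact.
  apply: (@squeeze_cvgr _ _ _ _ (fun=> 0) (fun n => `|cRe (x n - a)| + `|cIm (x n - a)|)).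
  - by apply: nearW => n; rewrite cabs_ge0 cabs_le.
  - exact: cvg_cst.
  - exact: h3.
split; apply/cvgrPdist_le => e e0; move/cvgrPdist_le/(_ _ e0) : h;
  apply: filterS => n; rewrite sub0r normrN ger0_norm ?cabs_ge0// cabs_dist => /(le_trans _); apply.
  by rewrite (le_trans _ (ler_cRe _))// cReD cReN.
by rewrite (le_trans _ (ler_cIm _))// cImD cImN.
Qed.

Lemma ccvg_seq_dist x y (a : R[i]) (e : nat -> R) : ccvg_seq y a ->
  (forall n, cabs (x n - y n) <= e n) -> e n @[n --> \oo] --> 0 -> ccvg_seq x a.
Proof.
move=> /ccvg_seqP ya xy e0; apply/ccvg_seqP.
have h : e n + cabs (y n - a) @[n --> \oo] --> 0 by rewrite -(addr0 0); apply: cvgD.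
apply: (@squeeze_cvgr _ _ _ _ (fun=> 0) (fun n => e n + cabs (y n - a))).
- apply: nearW => n; rewrite cabs_ge0 /= -(subrK (y n) (x n)) -addrA.
  by rewrite (le_trans (cabsD _ _))// lerD2r.
- exact: cvg_cst.
- exact: h.
Qed.

Lemma ccvg_seqV x (a : R[i]) : ccvg_seq x a -> a <> 0 -> ccvg_seq (fun n => (x n)^-1) a^-1.
Proof.
move=> [h1 h2] a0.
have VE z : z^-1 = Complex (cRe z * (cabs z ^+ 2)^-1) (- cIm z * (cabs z ^+ 2)^-1) :> R[i].
  by rewrite cabs_sqr; case: z => u v /=; apply: cRe_eq => /=; rewrite ?mulNr.
have hn : cabs (x n) ^+ 2 @[n --> \oo] --> cabs a ^+ 2.
  by under eq_fun do rewrite cabs_sqr; rewrite cabs_sqr; apply: cvgD; apply: cvgM.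
have an0 : cabs a ^+ 2 != 0.
  by rewrite sqrf_eq0; apply/eqP => /cabs_eq0.
split; rewrite VE; under eq_fun do rewrite VE; apply: cvgM; try exact: cvgV.
  exact: h1.
exact: cvgN.
Qed.

Lemma ccvg_seq_bounded x (a : R[i]) : ccvg_seq x a -> exists B, forall n, cabs (x n) <= B.
Proof.
move=> /ccvg_seqP h.
have /cvg_seq_bounded[M [_ hM]] : cvgn (fun n => cabs (x n - a)).
  by apply/cvg_ex; exists 0.
exists (`|M| + 1 + cabs a) => n.
rewrite -{1}(subrK a (x n)) (le_trans (cabsD _ _))// lerD2r.
by have := hM (`|M| + 1) (ltr_pwDr ltr01 (ler_norm M)) n I; rewrite /= ger0_norm ?cabs_ge0.
Qed.

Lemma ccvg_seq_le x (a : R[i]) (B : R) N : ccvg_seq x a ->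
  (forall n, (N <= n)%N -> cabs (x n) <= B) -> cabs a <= B.
Proof.
move=> /ccvg_seqP h hB; apply/ler_addgt0Pr => e e0.
have /cvgrPdist_le/(_ _ e0)[M _ hM] := h.
have := hM (maxn M N) (leq_maxl _ _); have := hB (maxn M N) (leq_maxr _ _).
rewrite /= sub0r normrN ger0_norm ?cabs_ge0// => h1 h2.
rewrite -(subrK (x (maxn M N)) a) (le_trans (cabsD _ _))// cabs_dist addrC lerD//.
Qed.

Lemma geometric_small (q B eps : R) : 0 <= q < 1 -> 0 < eps ->
  exists N, B * q ^+ N <= eps.
Proof.
move=> /andP[q0 q1] e0.
have : geometric B q @ \oo --> 0 by apply: cvg_geometric; rewrite ger0_norm.
move/cvgrPdist_le/(_ _ e0) => [N _ /(_ N (leqnn N))] /=.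
by rewrite sub0r normrN => h; exists N; rewrite (le_trans (ler_norm _)).
Qed.

Lemma geometric_tail (q : R) N m : 0 <= q < 1 ->
  \sum_(N <= k < m) q ^+ k <= q ^+ N / (1 - q).
Proof.
move=> /andP[q0 q1]; have q1' : 0 < 1 - q by rewrite subr_gt0.
rewrite ler_pdivlMr//.
have [mN|Nm] := leqP m N; first by rewrite big_geq// mul0r exprn_ge0.
have : forall n, (\sum_(N <= k < N + n) q ^+ k) * (1 - q) = q ^+ N - q ^+ (N + n).
  elim=> [|n IH]; first by rewrite addn0 big_geq// mul0r subrr.
  rewrite addnS big_nat_recr ?leq_addr//= mulrDl IH exprS; ring.
move/(_ (m - N)%N); rewrite subnKC; last exact: ltnW.
by move=> ->; rewrite lerBlDr lerDl exprn_ge0.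
Qed.

(** A Taylor polynomial of the dilate z |-> G (r z) does it: its coefficients decay geometrically,
    so the tail is uniformly small on the closed disc. *)
Lemma holo_disc_poly_approx G (r eps : R) : holo_disc G -> 0 <= r < 1 -> 0 < eps ->
  exists p, forall z, cabs z <= 1 -> cabs (p.[z] - G (Complex r 0 * z)) <= eps.
Proof.
move=> [a ha] /andP[r0 r1] e0.
(* At this intermediate radius the partial sums are bounded by some [B]; their consecutive
   differences give |a_k| rho^k <= 2 B, so the tail at radius [r] has ratio [r / rho]. *)
pose rho := (1 + r) / 2.
have rho0 : 0 < rho by rewrite /rho; lra.
have rho1 : rho < 1 by rewrite /rho; lra.
have rrho : r < rho by rewrite /rho; lra.
have crho : cabs (Complex rho 0) < 1 by rewrite cabs_real gtr0_norm.
have [B hB] := ccvg_seq_bounded (ha _ crho).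
have hcoef k : cabs (a k) * rho ^+ k <= 2 * B.
  have -> : cabs (a k) * rho ^+ k = cabs (a k * Complex rho 0 ^+ k).
    by rewrite cabsM cabsX cabs_real (gtr0_norm rho0).
  have -> : a k * Complex rho 0 ^+ k = \sum_(0 <= i < k.+1) a i * Complex rho 0 ^+ i
     - \sum_(0 <= i < k) a i * Complex rho 0 ^+ i.
    by rewrite big_nat_recr//= addrAC subrr add0r.
  by rewrite (le_trans (cabsB _ _))// mulr_natl mulr2n lerD.
pose q := r / rho.
have hq : 0 <= q < 1.
  by rewrite divr_ge0 ?(ltW rho0)//= ltr_pdivrMr// mul1r.
have q1 : 0 < 1 - q by case/andP : hq => _; rewrite subr_gt0.
have B0 : 0 <= B by rewrite (le_trans (cabs_ge0 _) (hB 0%N)).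
have [N hN] := geometric_small (2 * B / (1 - q)) hq e0.
exists (\poly_(k < N) (a k * Complex r 0 ^+ k)) => z z1.
have rz : cabs (Complex r 0 * z) < 1.
  rewrite cabsM cabs_real ger0_norm// (le_lt_trans _ r1)// -[leRHS]mulr1.
  by rewrite ler_wpM2l.
have -> : (\poly_(k < N) (a k * Complex r 0 ^+ k)).[z] =
    \sum_(0 <= k < N) a k * (Complex r 0 * z) ^+ k.
  by rewrite horner_poly big_mkord; apply: eq_bigr => k _; rewrite exprMn mulrA.
rewrite cabs_dist.
apply: (@ccvg_seq_le (fun m => \sum_(0 <= k < m) a k * (Complex r 0 * z) ^+ k -
   \sum_(0 <= k < N) a k * (Complex r 0 * z) ^+ k) _ _ N).
  have [h1 h2] := ha _ rz; split; rewrite ?cReD ?cImD ?cReN ?cImN.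
    under eq_fun do rewrite cReD cReN.
    by apply: cvgB => //; exact: cvg_cst.
  under eq_fun do rewrite cImD cImN.
  by apply: cvgB => //; exact: cvg_cst.
move=> m Nm; rewrite (big_cat_nat (n := N))//= addrAC subrr add0r.
rewrite (le_trans (cabs_sum _ _))// (le_trans _ hN)//.
apply: (@le_trans _ _ (\sum_(N <= k < m) 2 * B * q ^+ k)).
  apply: ler_sum => k _; rewrite cabsM cabsX cabsM cabs_real (ger0_norm r0).
  have rq : r = rho * q by rewrite /q mulrC divfK// gt_eqF.
  rewrite (_ : cabs (a k) * _ = cabs (a k) * rho ^+ k * (q ^+ k * cabs z ^+ k)); last first.
    by rewrite [in LHS]rq !exprMn; ring.
  have q0 : 0 <= q by case/andP : hq.
  have qk : 0 <= q ^+ k by rewrite exprn_ge0.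
  rewrite ler_pM ?mulr_ge0 ?cabs_ge0 ?exprn_ge0 ?cabs_ge0 ?(ltW rho0)//.
  by rewrite -[leRHS]mulr1 ler_wpM2l// exprn_ile1 ?cabs_ge0.
rewrite -big_distrr /= -[leRHS]mulrA [X in _ <= _ * X]mulrC ler_wpM2l ?mulr_ge0//.
exact: geometric_tail.
Qed.

(** All roots of [p] lie outside the closed disc, so each 1 / (z - a) is a uniform limit of
    geometric sums on the circle; the factors are treated one by one. *)
Lemma poly_inv_approx p (eps : R) : (forall z, cabs z <= 1 -> p.[z] <> 0) -> 0 < eps ->
  exists q, forall t, cabs (q.[expi t] * p.[expi t] - 1) <= eps.
Proof.
move=> hp e0; have [s ps] := closed_field_poly_normal p.
have c0 : lead_coef p != 0.
  apply/eqP => /eqP; rewrite lead_coef_eq0 => /eqP p0.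
  by apply: (hp 0); rewrite ?cabs0// p0 horner0.
have hs : forall a, a \in s -> 1 < cabs a.
  move=> a sa; rewrite ltNge; apply/negP => a1; apply: (hp a a1).
  rewrite ps hornerZ horner_prod; apply/eqP; rewrite mulf_eq0 prodf_seq_eq0.
  by apply/orP; right; apply/hasP; exists a => //=; rewrite !hornerE subrr.
suff [q hq] : exists q, forall t,
    cabs (q.[expi t] * (\prod_(a <- s) ('X - a%:P)).[expi t] - 1) <= eps.
  exists ((lead_coef p)^-1 *: q) => t.
  by rewrite {2}ps !hornerZ mulrACA mulVf// mul1r.
elim: s hs eps e0 {ps} => [|a s IH] hs eps e0.
  by exists 1 => t; rewrite big_nil hornerC mulr1 subrr cabs0 ltW.
(* From u v - 1 = (u - 1) v + (v - 1) the error is at most d (1 + d) + d <= 3 d. *)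
pose d := Num.min 1 (eps / 3).
have d0 : 0 < d by rewrite lt_min ltr01 divr_gt0.
have d1 : d <= 1 by rewrite /d ge_min lexx.
have d3 : 3 * d <= eps by rewrite mulrC -ler_pdivlMr// /d ge_min lexx orbT.
have [q hq] := IH (fun b sb => hs b (mem_behead (s := a :: s) sb)) d d0.
have a1 := hs a (mem_head _ _).
have a0 : a != 0 by apply/eqP => a0; move: a1; rewrite a0 cabs0 ltr10.
have ha : 0 <= (cabs a)^-1 < 1.
  by rewrite invr_ge0 cabs_ge0/= invf_lt1// (lt_trans ltr01).
have [N] := geometric_small 1 ha d0; rewrite mul1r => hN.
(* A truncation of 1 / (z - a) = - a^-1 (1 + z/a + (z/a)^2 + ...); the error after multiplying by z
   - a is - (z/a)^N. *)
pose q1 : {poly R[i]} := - a^-1 *: \poly_(k < N) (a^-1 ^+ k).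
have hq1 t : cabs (q1.[expi t] * (expi t - a) - 1) <= d.
  have -> : q1.[expi t] * (expi t - a) - 1 = - (expi t / a) ^+ N.
    have -> : q1.[expi t] * (expi t - a) = - ((expi t / a - 1) * \sum_(k < N) (expi t / a) ^+ k).
      rewrite /q1 hornerZ horner_poly.
      have -> : \sum_(k < N) a^-1 ^+ k * expi t ^+ k = \sum_(k < N) (expi t / a) ^+ k.
        by apply: eq_bigr => k _; rewrite exprMn mulrC.
      by field.
    by rewrite -subrX1; ring.
  by rewrite cabsN cabsX cabsM cabs_expi mul1r cabsV.
exists (q1 * q) => t; rewrite big_cons !hornerM mulrACA.
rewrite (_ : ('X - a%:P).[expi t] = expi t - a); last by rewrite !hornerE.
have h1 := hq1 t; have h2 := hq t.
set u := q1.[_] * _ in h1 *; set v := q.[_] * _ in h2 *.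
have -> : u * v - 1 = (u - 1) * v + (v - 1) by ring.
have hv : cabs v <= 1 + d.
  by rewrite -(subrK 1 v) (le_trans (cabsD _ _))// cabs1 addrC lerD2l.
rewrite (le_trans (cabsD _ _))// (le_trans _ d3)// cabsM.
have := ler_pM (cabs_ge0 _) (cabs_ge0 _) h1 hv; nra.
Qed.

End PolynomialApproximation.

(** * The boundary function and its reciprocal *)

Section BoundaryValues.
Context {R : realType}.
Local Notation mu := (@lebesgue_measure R).
Implicit Types (G : R[i] -> R[i]) (p q : {poly R[i]}) (g b : R -> R[i]).

Lemma blim_of_cvg b (N : set (measurableTypeR R)) (P : nat -> {poly R[i]}) (c : R) (z : R[i]) :
  measurable N -> mu N = 0 -> (forall n t, cabs (P n).[expi t] <= c) ->
  (forall t, Tdom t -> ~ N t -> ccvg_seq (fun n => (P n).[expi t]) (b t)) ->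
  (forall t, Tdom t -> N t -> b t = z) -> blim b.
Proof.
move=> mN N0 Pc Pb bz.
(* Replacing the polynomials by the constant [z] on [N] gives measurable functions converging to [b]
   on all of [Tdom], whence the measurability of [b]. *)
pose F n t : R[i] := (P n).[expi t] * Complex (1 - \1_N t) 0 + z * Complex (\1_N t) 0.
have mI : cmeas (fun t => Complex (\1_N t) 0 : R[i]).
  by split; [exact: measurable_indic|exact: measurable_cst].
have mI' : cmeas (fun t => Complex (1 - \1_N t) 0 : R[i]).
  by split; [apply: measurable_funB => //; exact: measurable_indic|exact: measurable_cst].
have mF n : cmeas (F n).
  have [h1 h2] := cmeasM (@cmeas_poly R (P n)) mI'.
  have [h3 h4] : cmeas (fun t => z * Complex (\1_N t) 0 : R[i]).
    by apply: cmeasM => //; split; exact: measurable_cst.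
  split; rewrite /F; [under eq_fun do rewrite cReD|under eq_fun do rewrite cImD];
    exact: measurable_funD.
have Fb t : Tdom t -> ccvg_seq (F ^~ t) (b t).
  move=> Dt; have [Nt|Nt] := pselect (N t).
    rewrite bz// (_ : F ^~ t = fun=> z); first by split; exact: cvg_cst.
    apply/funext => n; rewrite /F indicE mem_set//=.
    by apply: cRe_eq; rewrite ?cReD ?cImD ?cReM ?cImM /=; ring.
  rewrite (_ : F ^~ t = fun n => (P n).[expi t]); first exact: Pb.
  apply/funext => n; rewrite /F indicE memNset//=.
  by apply: cRe_eq; rewrite ?cReD ?cImD ?cReM ?cImM /=; ring.
split.
- split; [apply: (@measurable_fun_cvg _ _ _ _ (fun n t => cRe (F n t))) |
          apply: (@measurable_fun_cvg _ _ _ _ (fun n t => cIm (F n t)))].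
  + by move=> n; exact: (mF n).1.
  + by move=> t Dt; exact: (Fb t Dt).1.
  + by move=> n; exact: (mF n).2.
  + by move=> t Dt; exact: (Fb t Dt).2.
- exists (c + cabs z) => t Dt; have [Nt|Nt] := pselect (N t).
    by rewrite bz// lerDr (le_trans (cabs_ge0 _) (Pc 0%N 0)).
  rewrite (le_trans (_ : _ <= c)) ?lerDl ?cabs_ge0//.
  by apply: (ccvg_seq_le (N := 0%N) (Pb t Dt Nt)) => n _.
- exists P, c; split=> //; exists N; split=> // t.
  by apply: contra_notP => Nt Dt; exact: Pb.
Qed.

Lemma boundary_blim G g : Hinf G -> boundary_values G g ->
  (forall z : R[i], cabs z < 1 -> 1 <= cabs (G z)) ->
  {ae mu, forall t, Tdom t -> 1 < cabs (g t)} ->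
  exists (N : set (measurableTypeR R)) (gb : R -> R[i]), [/\ measurable N, mu N = 0,
    forall t, Tdom t -> ~ N t -> gb t = g t,
    blim gb /\ blim (fun t => (gb t)^-1) & forall t, Tdom t -> 1 < cabs (gb t)].
Proof.
move=> [holG [M hM]] hg hGD hg1.
have [N [mN N0 hN]] := ae_and hg hg1.
(* The index [n.+2] makes [r n] nonnegative and the approximation error at most 1/2. *)
pose r (n : nat) : R := 1 - n.+2%:R^-1.
have r01 n : 0 <= r n < 1.
  by rewrite /r subr_ge0 invf_le1// ler1n/= gtrBl invr_gt0.
have e0 n : 0 < n.+2%:R^-1 :> R by rewrite invr_gt0.
have e0' n : 0 < n.+1%:R^-1 :> R by rewrite invr_gt0.
have ehalf n : n.+2%:R^-1 <= 2^-1 :> R by rewrite lef_pV2 ?posrE// ler_nat.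
have c1 : n.+1%:R^-1 @[n --> \oo] --> (0 : R) by exact: cvg_harmonic.
have c2 : n.+2%:R^-1 @[n --> \oo] --> (0 : R).
  by have := cvg_comp (addn 1) (fun n => n.+1%:R^-1 : R) (cvg_addnl 1) c1.
pose P n := sval (cid (holo_disc_poly_approx holG (r01 n) (e0 n))).
have hP n z : cabs z <= 1 -> cabs ((P n).[z] - G (Complex (r n) 0 * z)) <= n.+2%:R^-1.
  exact: (svalP (cid (holo_disc_poly_approx holG (r01 n) (e0 n)))).
have rz n z : cabs z <= 1 -> cabs (Complex (r n) 0 * z) < 1.
  move=> z1; have /andP[h1 h2] := r01 n.
  rewrite cabsM cabs_real ger0_norm// (le_lt_trans _ h2)// -[leRHS]mulr1.
  by rewrite ler_wpM2l.
(* Since |G| >= 1 on the disc and the error is at most 1/2, [P n] has no zero in the closed disc. *)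
have hPlow n z : cabs z <= 1 -> 2^-1 <= cabs (P n).[z].
  move=> z1; have := hGD _ (rz n z z1); have := le_trans (hP n z z1) (ehalf n).
  have := cabsD (P n).[z] (G (Complex (r n) 0 * z) - (P n).[z]).
  rewrite subrKC (cabs_dist (G _)); lra.
have hPup n t : cabs (P n).[expi t] <= M + 1.
  have z1 : cabs (expi t : R[i]) <= 1 by rewrite cabs_expi.
  rewrite -[X in cabs X](subrK (G (Complex (r n) 0 * expi t))) (le_trans (cabsD _ _))//.
  have := hM _ (rz n _ z1); have := le_trans (hP n _ z1) (ehalf n); lra.
have hP0 n z : cabs z <= 1 -> (P n).[z] <> 0.
  by move=> z1 h; have := hPlow n z z1; rewrite h cabs0; lra.
pose Q n := sval (cid (poly_inv_approx (hP0 n) (e0' n))).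
have hQ n t : cabs ((Q n).[expi t] * (P n).[expi t] - 1) <= n.+1%:R^-1.
  exact: (svalP (cid (poly_inv_approx (hP0 n) (e0' n)))).
(* |Q P| <= 2 and |P| >= 1/2. *)
have hQup n t : cabs (Q n).[expi t] <= 4.
  have := hQ n t; have := hPlow n (expi t); rewrite cabs_expi => /(_ (lexx _)) h1 h2.
  have h3 : cabs ((Q n).[expi t] * (P n).[expi t]) <= 2.
    rewrite -[X in cabs X](subrK 1) (le_trans (cabsD _ _))// cabs1.
    have h4 : n.+1%:R^-1 <= 1 :> R by rewrite invf_le1// ler1n.
    have := le_trans h2 h4; lra.
  rewrite cabsM in h3; have := cabs_ge0 (Q n).[expi t]; nra.
(* Any constant of modulus greater than 1 would serve on [N]; the bound [1 < cabs (gb t)] then holds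
   at every point of [Tdom]. *)
pose gb t := if t \in N then 2 else g t.
have gbE t : ~ N t -> gb t = g t by move=> Nt; rewrite /gb memNset.
have gbN t : N t -> gb t = 2 by move=> Nt; rewrite /gb mem_set.
have good t : Tdom t -> ~ N t -> ccvg_seq (fun n => (P n).[expi t]) (g t) /\ 1 < cabs (g t).
  move=> Dt Nt; have [h1 h2] : (Tdom t ->
    (fun r : R => cRe (G (Complex r 0 * expi t))) @ at_left 1 --> cRe (g t) /\
    (fun r : R => cIm (G (Complex r 0 * expi t))) @ at_left 1 --> cIm (g t)) /\
    (Tdom t -> 1 < cabs (g t)).
    by apply: contrapT => h; apply: Nt; exact: hN.
  split; last exact: h2.
  apply: (@ccvg_seq_dist _ _ (fun n => G (Complex (r n) 0 * expi t)) _ (fun n => n.+2%:R^-1)) => //.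
    have rl : (forall n, r n < 1) /\ r @ \oo --> (1 : R).
      split=> [n|]; first by case/andP : (r01 n).
      by rewrite -[X in _ --> X]subr0; apply: cvgB; first exact: cvg_cst.
    have [/cvg_at_leftP k1 /cvg_at_leftP k2] := h1 Dt.
    by split; [exact: k1 rl|exact: k2 rl].
  by move=> n; apply: hP; rewrite cabs_expi.
have two : cabs (2 : R[i]) = 2.
  by rewrite (_ : 2 = Complex 2 0 :> R[i]) ?cabs_real ?gtr0_norm//; apply: cRe_eq => /=; rewrite ?addr0.
have hgb1 t : Tdom t -> 1 < cabs (gb t).
  move=> Dt; have [Nt|Nt] := pselect (N t); last by rewrite gbE//; case: (good t Dt Nt).
  by rewrite gbN// two ltr1n.
exists N, gb; split=> //; first by move=> t _; exact: gbE.
split.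
  apply: (blim_of_cvg mN N0 hPup) => t Dt Nt; last exact: gbN.
  by rewrite gbE//; have [] := good t Dt Nt.
apply: (blim_of_cvg mN N0 hQup (z := 2^-1)) => t Dt Nt; last by rewrite gbN.
have [k1 k2] := good t Dt Nt; rewrite gbE//.
have g0 : g t <> 0 by move=> h; move: k2; rewrite h cabs0; lra.
have k3 : ccvg_seq (fun n => (Q n).[expi t] * (P n).[expi t]) 1.
  apply: (@ccvg_seq_dist _ _ (fun=> 1) _ (fun n => n.+1%:R^-1)) => //.
  by split; exact: cvg_cst.
have := ccvg_seqM k3 (ccvg_seqV k1 g0); rewrite mul1r.
rewrite (_ : (fun n => (Q n).[expi t] * (P n).[expi t] * (P n).[expi t]^-1) =
  fun n => (Q n).[expi t])//.
by apply/funext => n; rewrite mulfK//; apply/eqP; apply: (hP0 n); rewrite cabs_expi.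
Qed.

End BoundaryValues.

(** * Growth of the adjoint iterates *)

Section Growth.
Context {R : realType}.
Local Notation mu := (@lebesgue_measure R).
Implicit Types (A : (R -> R[i]) -> (R -> R[i])) (f g u gb : R -> R[i]).

(** (1 - y)^n <= e^(-ny), while (ny)^(K+1) <= (K+1)! e^(ny) by the exponential series. *)
Lemma pow_mul_pow_le (y : R) n K : 0 <= y <= 1 -> (0 < n)%N ->
  (1 - y) ^+ n * y ^+ K.+1 <= K.+1`!%:R / n%:R ^+ K.+1.
Proof.
move=> /andP[y0 y1] n0.
have nR : 0 < n%:R :> R by rewrite ltr0n.
have fR : 0 < K.+1`!%:R :> R by rewrite ltr0n fact_gt0.
rewrite ler_pdivlMr ?exprn_gt0// -mulrA -exprMn.
have h1 : (1 - y) ^+ n <= expR (- (n%:R * y)).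
  rewrite -mulrN expRM_natl lerXn2r ?nnegrE ?subr_ge0 ?expR_ge0//.
  exact: expR_ge1Dx.
have h2 : (y * n%:R) ^+ K.+1 <= K.+1`!%:R * expR (n%:R * y).
  have ny0 : 0 <= n%:R * y by rewrite mulr_ge0// ltW.
  rewrite -ler_pdivrMl// mulrC [y * _]mulrC.
  by apply: le_trans (expR_ge1Dxn K ny0); rewrite lerDr.
have h3 : 0 <= (y * n%:R) ^+ K.+1 by rewrite exprn_ge0// mulr_ge0// ltW.
have h4 : 0 <= (1 - y) ^+ n by rewrite exprn_ge0// subr_ge0.
rewrite (le_trans (ler_pM h4 h3 h1 h2))// mulrCA -expRD addrC subrr expR0 mulr1//.
Qed.

Lemma H2_iter A g f n : is_Toeplitz_adjoint g A -> H2 f -> H2 (iter n A f).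
Proof. by move=> [hA _] hf; elim: n => [//|n IH]; exact: hA. Qed.

(** Because [gb * u] already lies in [H2], it can play the role of the projection [w], and the
    factors move across the inner product one at a time. *)
Lemma ip_iter_adjoint A g gb (N : set (measurableTypeR R)) : is_Toeplitz_adjoint g A ->
  measurable N -> mu N = 0 -> (forall t, Tdom t -> ~ N t -> gb t = g t) -> blim gb ->
  forall n u f, blim u -> H2 f ->
    ip (fun t => gb t ^+ n * u t) f = ip u (iter n A f).
Proof.
move=> hA mN N0 gbg hgb; elim=> [|n IH] u f hu hf.
  by apply: eq_cint => t _; rewrite expr0 mul1r.
transitivity (ip (fun t => gb t ^+ n * (gb t * u t)) f).
  by apply: eq_cint => t _; rewrite exprSr (mulrA (gb t ^+ n)). 
have hgu := blimM hgb hu; rewrite (IH _ _ hgu hf).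
apply: (hA.2 u (iter n A f) (fun t => gb t * u t)); [exact: blim_H2|exact: (H2_iter n hA hf)|exact: blim_H2|].
(* The difference of [g * u] and [gb * u] vanishes off [N]; [avg_null] applies although [g] is not
   known to be measurable. *)
move=> v _; apply: cRe_eq => /=; rewrite -[LHS]/(avg _);
  by apply: (avg_null mN N0) => t Dt Nt; rewrite gbg// subrr mul0r.
Qed.

(** Dominated convergence: the truncation is bounded by [|l|] and equals 0 at [t] as soon as [m]
    exceeds [|l t|]. *)
Lemma min_shift_small (l : R -> R) (eps : R) : intg l -> 0 < eps ->
  exists m : nat, intg (fun t => Num.min (l t + m%:R) 0) /\
    avg (fun t => `|Num.min (l t + m%:R) 0|) <= eps.
Proof.
move=> il e0.
have ml := intg_measurable il.
have mm m : measurable_fun Tdom (fun t => Num.min (l t + m%:R) 0).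
  by apply: measurable_minr; [apply: measurable_funD => //; exact: measurable_cst|exact: measurable_cst].
have hle m t : `|Num.min (l t + m%:R) 0| <= `|l t|.
  have m0 := ler0n R m; rewrite ler0_norm ?ge_min ?lexx ?orbT//.
  rewrite oppr_min oppr0 ge_max normr_ge0 andbT.
  by have := ler_norm (- l t); rewrite normrN; lra.
have [|||||_ hl] := @avg_dominated R (fun m t => `|Num.min (l t + m%:R) 0|) (fun=> 0)
  (fun t => `|l t|).
- by move=> m; apply: measurableT_comp.
- exact: measurable_cst.
- apply: ae_all => t _; apply/cvgrPdist_le => e e1.
  exists (Num.Def.archi_bound `|l t|) => // m /= hm.
  have : `|l t| < m%:R by rewrite (lt_le_trans (archi_boundP _))// ler_nat.
  have := ler_norm (- l t); rewrite normrN => h1 h2.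
  by rewrite min_r ?normr0 ?subrr ?normr0 ?ltW//; lra.
- exact: intg_norm.
- by move=> m t _; rewrite normr_id.
move: hl; rewrite avg_cst => /cvgrPdist_le/(_ _ e0)[m _ /(_ m (leqnn m)) /=].
rewrite sub0r normrN => /(le_trans (ler_norm _)) h; exists m; split=> //.
by apply: (intg_le (mm m) (intg_norm il)) => t _.
Qed.

Lemma adjoint_growth A g gb (N : set (measurableTypeR R)) f K :
  is_Toeplitz_adjoint g A -> measurable N -> mu N = 0 ->
  (forall t, Tdom t -> ~ N t -> gb t = g t) -> blim gb -> blim (fun t => (gb t)^-1) ->
  (forall t, Tdom t -> 1 < cabs (gb t)) -> intg (fun t => ln (cabs (gb t) - 1)) ->
  H2 f -> ~ {ae mu, forall t, Tdom t -> f t = 0} ->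
  exists2 c : R, 0 < c & forall n, (0 < n)%N -> c * n%:R ^+ K.+1 <= l2norm (iter n A f).
Proof.
move=> hA mN N0 gbg hgb hgbV gb1 hlog hf fn0.
have [j hj] := H2_coef_neq0 hf fn0.
pose c0 := cabs (ip (fun t => expi t ^+ j) f).
have c00 : 0 < c0.
  by rewrite lt_neqAle cabs_ge0 andbT eq_sym; apply/eqP => /cabs_eq0.
pose x t := (cabs (gb t))^-1.
have x01 t : Tdom t -> 0 <= x t < 1.
  by move=> Dt; rewrite invr_ge0 cabs_ge0/= invf_lt1 ?gb1// (lt_trans ltr01 (gb1 t Dt)).
have mgb := measurable_cabs (L2_cmeas (blim_L2 hgb)).
have mx : measurable_fun Tdom x.
  have := measurable_cabs (L2_cmeas (blim_L2 hgbV)).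
  by rewrite /x; under eq_fun do rewrite cabsV.
(* Chosen so that the exponential of [l] is (1 - x)^(2(K+1)), with x = 1/|gb|. *)
pose l t := (2 * K.+1)%:R * (ln (cabs (gb t) - 1) - ln (cabs (gb t))).
have il : intg l.
  apply: intgZ; apply: intgB => //.
  have [_ [c hc] _] := hgb; apply: (@intg_bounded _ _ c).
    by apply: measurableT_comp => //; exact: measurable_ln.
  move=> t Dt; have h1 := gb1 t Dt; rewrite ger0_norm; last by rewrite ln_ge0 ?ltW.
  by rewrite (le_trans _ (hc t Dt))// ltW// ln_sublinear// (lt_trans ltr01).
have expl t : Tdom t -> expR (l t) = (1 - x t) ^+ (2 * K.+1).
  move=> Dt; have h1 := gb1 t Dt; have h0 : 0 < cabs (gb t) by rewrite (lt_trans ltr01).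
  rewrite expRM_natl expRD expRN !lnK ?posrE ?subr_gt0//; congr (_ ^+ _).
  by rewrite /x mulrBl mul1r mulfV// gt_eqF.
(* The weight makes [s^-1 * sqn f] at most [c0 / 4]; adding 1 keeps it positive. Then [kap]
   satisfies s kap = c0 / 4. As [m], [D] and [E] below, they are fixed before [n]. *)
pose s : R := 4 * sqn f / c0 + 1.
have f0 := sqn_ge0 f.
have s0 : 0 < s by rewrite ltr_pwDr//; apply: divr_ge0; [exact: mulr_ge0|exact: ltW].
have hs : s^-1 * sqn f <= c0 / 4.
  rewrite ler_pdivrMl// (_ : s * _ = sqn f + c0 / 4); first by rewrite lerDl divr_ge0// ltW.
  by rewrite /s; field; rewrite gt_eqF.
pose kap := c0 / (4 * s).
have kap0 : 0 < kap by rewrite divr_gt0// mulr_gt0.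
have [m [ixi hxi]] := min_shift_small il (divr_gt0 kap0 (@ltr0n R 2)).
pose xi t := Num.min (l t + m%:R) 0.
have xi0 t : xi t <= 0 by rewrite /xi ge_min lexx orbT.
pose D : R := expR m%:R * K.+1`!%:R ^+ 2 + 2.
have D0 : 0 < D by rewrite ltr_pwDr// mulr_ge0 ?expR_ge0// exprn_ge0.
pose E := c0 ^+ 2 / (16 * D).
have E0 : 0 < E by rewrite divr_gt0 ?exprn_gt0 ?mulr_gt0.
exists (Num.sqrt E); first by rewrite sqrtr_gt0.
move=> n n0; have nR : 0 < n%:R :> R by rewrite ltr0n.
pose nK : R := n%:R ^+ K.+1.
have nK0 : 0 < nK by rewrite exprn_gt0.
(* The first bound gives sqn (p - 1) <= kap / 2 + 2 kap / 4 = kap; the second makes the error in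
   [sqn u] of order n^(-2(K+1)). *)
pose eps := Num.min (kap / 4) (nK ^+ 2)^-1.
have eps0 : 0 < eps by rewrite lt_min divr_gt0// invr_gt0 exprn_gt0.
have [p [hp1 hp2]] := almost_outer ixi (fun t _ => xi0 t) eps0.
have epsk : eps <= kap / 4 by rewrite /eps ge_min lexx.
have epsn : eps <= (nK ^+ 2)^-1 by rewrite /eps ge_min lexx orbT.
pose w t := ('X^j * p).[expi t].
have wE t : w t = expi t ^+ j * p.[expi t] by rewrite /w hornerM hornerXn.
have hw : blim w := blim_poly _.
(* Replacing [p] by 1 in [w] turns the inner product into the nonzero coefficient of modulus [c0];
   the change costs at most c0/4 + c0/4. *)
have hwip : c0 / 2 <= cabs (ip w f).
  have hX := L2_poly ('X^j : {poly R[i]}); have hX1 := L2_poly ('X^j * (p - 1)).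
  have e1 : ip w f = ip (fun t => ('X^j).[expi t]) f + ip (fun t => ('X^j * (p - 1)).[expi t]) f.
    rewrite /ip -cintD; [|exact: (cintg_ip hX hf.1)|exact: (cintg_ip hX1 hf.1)].
    by apply: eq_cint => t _; rewrite wE !(hornerM, hornerXn, hornerD, hornerN, hornerC); ring.
  have e2 : ip (fun t => ('X^j).[expi t]) f = ip (fun t => expi t ^+ j) f.
    by apply: eq_cint => t _; rewrite hornerXn.
  have h1 := ip_amgm hX1 hf.1 s0.
  have e3 : sqn (fun t => ('X^j * (p - 1)).[expi t]) = sqn (fun t => p.[expi t] - 1).
    apply: eq_avg => t _; rewrite !(hornerM, hornerXn, hornerD, hornerN, hornerC).
    by rewrite cabsM cabsX cabs_expi expr1n mul1r.
  have h2 : s * sqn (fun t => p.[expi t] - 1) <= c0 / 4.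
    have h3 : sqn (fun t => p.[expi t] - 1) <= kap by move: hp1; rewrite -/(xi _); lra.
    by rewrite (le_trans (ler_wpM2l (ltW s0) h3))// /kap le_eqVlt; apply/orP; left; apply/eqP; field; rewrite gt_eqF.
  have h4 := cabsB (ip w f) (ip (fun t => ('X^j * (p - 1)).[expi t]) f).
  move: h4; rewrite {1}e1 addrK e2 -/c0; rewrite e3 in h1; lra.
pose u t := ((gb t)^-1) ^+ n * w t.
have hu : blim u by apply: blimM => //; exact: blimX.
have uip : ip w f = ip u (iter n A f).
  rewrite -(ip_iter_adjoint hA mN N0 gbg hgb)//; apply: eq_cint => t Dt.
  rewrite /u mulrA -exprMn mulfV ?expr1n ?mul1r//.
  by apply/eqP => g0; move: (gb1 t Dt); rewrite g0 cabs0 ltr10.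
have hsu : sqn u <= D / nK ^+ 2.
  have -> : sqn u = avg (fun t => x t ^+ (2 * n) * cabs p.[expi t] ^+ 2).
    apply: eq_avg => t _; rewrite /u wE !cabsM !cabsX cabsV cabs_expi expr1n mul1r.
    by rewrite exprMn -exprM mulnC.
  have mxn : measurable_fun Tdom (fun t => x t ^+ (2 * n)) by exact: measurable_funX.
  have hx2 t : Tdom t -> 0 <= x t ^+ (2 * n) <= 1.
    by move=> /x01/andP[h1 h2]; rewrite exprn_ge0//= exprn_ile1// ltW.
  have DE : D / nK ^+ 2 = expR m%:R * K.+1`!%:R ^+ 2 / nK ^+ 2 + 2 * (nK ^+ 2)^-1.
    by rewrite /D mulrDl.
  rewrite DE; apply: le_trans (hp2 _ mxn hx2) _; apply: lerD; last by rewrite ler_pM2l.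
  rewrite -[leRHS](@avg_cst R); apply: avg_le; last first.
  - move=> t Dt; have /andP[h1 h2] := x01 t Dt.
    (* This factor compensates for the slow decay of x^(2n) where x is near 1; [pow_mul_pow_le] at y
       = 1 - x bounds the product. *)
    have h3 : expR (xi t) <= expR m%:R * (1 - x t) ^+ (2 * K.+1).
      by rewrite -expl// -expRD ler_expR addrC /xi ge_min lexx.
    have h4 := @pow_mul_pow_le (1 - x t) n K.
    rewrite opprB addrCA subrr addr0 in h4.
    have /h4/(_ n0) h5 : 0 <= 1 - x t <= 1 by apply/andP; split; lra.
    have h6 : 0 <= x t ^+ n * (1 - x t) ^+ K.+1.
      by rewrite mulr_ge0 ?exprn_ge0//; lra.
    have /andP[h7 _] := hx2 t Dt.
    apply: (le_trans (ler_wpM2l h7 h3)).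
    rewrite mulrCA -[leRHS]mulrA; apply: ler_wpM2l; first exact: expR_ge0.
    rewrite (_ : x t ^+ (2 * n) * _ = (x t ^+ n * (1 - x t) ^+ K.+1) ^+ 2); last first.
      by rewrite exprMn -!exprM !(mulnC 2).
    rewrite (_ : _ ^+ 2 / _ = (K.+1`!%:R / nK) ^+ 2); last by rewrite exprMn exprVn.
    by rewrite lerXn2r// nnegrE ?(le_trans h6 h5).
  - exact: intg_cst.
  - apply: (@intg_bounded _ _ 1).
      apply: measurable_funM => //; apply: measurableT_comp; first exact: measurable_expR.
      exact: intg_measurable.
    move=> t Dt; have /andP[h1 h2] := hx2 t Dt.
    rewrite ger0_norm ?mulr_ge0 ?expR_ge0// -[leRHS]mulr1 ler_pM ?expR_ge0//.
    by rewrite -[leRHS]expR0 ler_expR xi0.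
(* The weight for which [s' * sqn u <= c0 / 4]; half of the lower bound [c0 / 2] is then left for
   the iterate, and s' c0 / 4 = E n^(2(K+1)). *)
pose s' := c0 * nK ^+ 2 / (4 * D).
have s'0 : 0 < s' by rewrite divr_gt0 ?mulr_gt0 ?exprn_gt0.
have hH := H2_iter n hA hf.
have h1 := ip_amgm (blim_L2 hu) hH.1 s'0; rewrite -uip in h1.
have h2 : s' * sqn u <= c0 / 4.
  rewrite (le_trans (ler_wpM2l (ltW s'0) hsu))// /s' le_eqVlt; apply/orP; left; apply/eqP.
  by field; rewrite !gt_eqF.
have h3 : c0 / 4 <= s'^-1 * sqn (iter n A f) by lra.
rewrite ler_pdivlMl// in h3.
rewrite -(ler_pXn2r (n := 2))// ?nnegrE ?sqrtr_ge0 ?mulr_ge0 ?sqrtr_ge0 ?(ltW nK0)//.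
rewrite l2norm_sqr exprMn sqr_sqrtr ?(ltW E0)// (le_trans _ h3)// /E /s' -/nK.
by rewrite le_eqVlt; apply/orP; left; apply/eqP; field; rewrite gt_eqF.
Qed.

End Growth.

(** * From polynomial lower bounds to the limit *)

Lemma powR_growth {R : realType} (X : nat -> R) (k c : R) (K : nat) : 0 < c ->
  k + 1 <= K%:R -> (forall n, (0 < n)%N -> c * n%:R ^+ K <= X n) ->
  (n%:R `^ (- k)) * X n @[n --> \oo] --> +oo.
Proof.
move=> c0 kK hX; apply/cvgryPge => B.
exists (Num.Def.archi_bound (`|B| / c)).+1 => // n /= hn.
have n0 : (0 < n)%N by rewrite (leq_trans _ hn).
have n1 : 1 <= n%:R :> R by rewrite ler1n.
have hB : B <= c * n%:R.
  rewrite (le_trans (ler_norm _))// mulrC -ler_pdivrMr// ltW//.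
  by rewrite (lt_trans (archi_boundP _)) ?divr_ge0 ?(ltW c0)// ltr_nat.
have h1 : n%:R <= n%:R `^ (- k) * n%:R ^+ K.
  rewrite -powR_mulrn ?ler0n// -powRD; last first.
    by apply/implyP => _; rewrite pnatr_eq0 -lt0n.
  by rewrite -[leLHS]powRr1 ?ler0n// ler_powR//; lra.
rewrite (le_trans hB)//; apply: le_trans (ler_wpM2l (powR_ge0 _ _) (hX n n0)).
by rewrite mulrCA ler_wpM2l// ltW.
Qed.

(** [gb] supplies the measurability; integrability comes from [g] off [N], where the two agree, and
    the null set is then put back. *)
Lemma intg_ln_boundary {R : realType} (g gb : R -> R[i]) (N : set (measurableTypeR R)) :
  measurable N -> (@lebesgue_measure R) N = 0 -> (forall t, Tdom t -> ~ N t -> gb t = g t) ->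
  cmeas gb -> (@lebesgue_measure R).-integrable Tdom (fun t => (ln (cabs (g t) - 1))%:E) ->
  intg (fun t => ln (cabs (gb t) - 1)).
Proof.
move=> mN N0 gbg mgb hlog.
have mF : measurable_fun Tdom (fun t => ln (cabs (gb t) - 1)).
  apply: measurableT_comp; first exact: measurable_ln.
  by apply: measurable_funB; [exact: measurable_cabs|exact: measurable_cst].
apply/(negligible_integrable mN measurable_Tdom _ N0); first exact/measurable_EFinP.
have mD := measurableD measurable_Tdom mN.
apply: (eq_integrable mD _ _ _ (integrableS measurable_Tdom mD _ hlog)) => //.
by move=> t /set_mem[Dt Nt] /=; rewrite gbg.
Qed.

Unset Implicit Arguments.
Set Strict Implicit.

Theorem theorem6p2 (R : realType) (G : R[i] -> R[i]) (g : R -> R[i])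
  (hG : Hinf G) (hg : boundary_values G g)
  (hGD : forall z : R[i], cabs z < 1 -> 1 <= cabs (G z))
  (hg1 : {ae (@lebesgue_measure R), forall t, Tdom t -> 1 < cabs (g t)})
  (hlog : (@lebesgue_measure R).-integrable Tdom
            (fun t => (ln (cabs (g t) - 1))%:E))
  (A : (R -> R[i]) -> (R -> R[i])) (hA : is_Toeplitz_adjoint g A) :
  forall (k : R), 0 < k ->
  forall f : R -> R[i], H2 f ->
    ~ {ae (@lebesgue_measure R), forall t, Tdom t -> f t = 0} ->
    (fun n : nat => (n%:R `^ (- k)) * l2norm (iter n A f)) @ \oo --> +oo.
Proof.
move=> k k0 f hf fn0.
have [N [gb [mN N0 gbg [hgb hgbV] gb1]]] := boundary_blim hG hg hGD hg1.
have hl := intg_ln_boundary mN N0 gbg (L2_cmeas (blim_L2 hgb)) hlog.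
(* The exponent [K.+1] is at least k + 1, so n^(-k) times n^(K+1) is at least n. *)
pose K := Num.Def.archi_bound (k + 1).
have kK : k + 1 <= K.+1%:R.
  have h : 0 <= k + 1 by rewrite addr_ge0// ltW.
  by rewrite ltW// (lt_trans (archi_boundP h))// ltr_nat.
have [c c0 hc] := adjoint_growth K hA mN N0 gbg hgb hgbV gb1 hl hf fn0.
exact: powR_growth c0 kK hc.
Qed.
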